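(* Let $\psi(x,z)$ be a Darboux transform of $e^{xz}$, with monic polynomials $f,g$ and monic operators $P,Q$ such that $\psi=\frac1{f(z)}Pe^{xz}$, $e^{xz}=\frac1{g(z)}Q\psi$ and $\mathrm{ord}\,P=\deg f$. Write $h(\partial)=f(\partial)g(\partial)=Q P$ in the form $$h(\partial)=\prod_{r=1}^n\prod_{j=0}^{n_r}(\partial-\lambda_r+j)^{m_{r,j}},$$ where the $\lambda_r$ are distinct, $\lambda_r-\lambda_s\notin\mathbb{Z}$ for $r\neq s$, the $m_{r,j}$ are nonnegative integers, and $m_{r,0}>0$. Let $$W_r=\mathrm{span}\{x^ke^{(\lambda_r-j)x}:0\le k\le m_{r,j}-1,\ 0\le j\le n_r\}.$$ Then $\psi$ is trigonometric (i.e. $P,Q\in\mathbb{C}(e^x)[\partial]$) if and only if $\ker P=\bigoplus_{r=1}^nK_r$, where each $K_r$ is a subspace of $W_r$ having a basis that is a union of sets of the form $$\Big\{\frac{1}{l!}\partial_y^l\Big(\sum_{j=0}^{n_r}\sum_{k=0}^{m_{r,j}-1}c_{r,k,j}\,y^k e^{(\lambda_r-j)x}\Big)\Big|_{y=x}\ :\ l=0,1,\dots,l_0\Big\},$$ for complex constants $c_{r,k,j}$, where $l_0=\max\{k:\ c_{r,k,j}\neq0\text{ for some }j\}$.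
   Context: Notation: $\partial=\frac{\partial}{\partial x}$. Darboux transform: a function $\psi(x,z)$ is a Darboux transform of $e^{xz}$ if there exist monic polynomials $f,g$ and monic differential operators $P,Q$ with $\psi=\frac1{f(z)}Pe^{xz}$, $e^{xz}=\frac1{g(z)}Q\psi$, and the order of $P$ equal to $\deg f$. Trigonometric: a Darboux transform is called trigonometric if $P$ and $Q$ have coefficients that are rational functions of $e^x$. *)

(* Defs.v *)
From HB Require Import structures.
From mathcomp Require Import all_boot all_order all_algebra.
Set Implicit Arguments. Unset Strict Implicit. Unset Printing Implicit Defensive.
Import Order.TTheory GRing.Theory Num.Theory.
Local Open Scope ring_scope.

(* An abstract "function field" K: a differential field whose field of
   constants is (the image of) the constant field C, containing the
   function x (X, with X' = 1) and all exponentials e^{a x} (Ex a). *)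
Record exp_diff_field (C : closedFieldType) (K : fieldType) := ExpDiffField {
  cst : {rmorphism C -> K};
  D : K -> K;
  D_add : forall a b, D (a + b) = D a + D b;
  D_mul : forall a b, D (a * b) = D a * b + a * D b;
  D_const : forall a, D a = 0 <-> exists c, a = cst c;
  X : K;
  D_X : D X = 1;
  Ex : C -> K;
  Ex0 : Ex 0 = 1;
  ExD : forall a b, Ex (a + b) = Ex a * Ex b;
  D_Ex : forall a, D (Ex a) = cst a * Ex a
}.

Section Defs.
Variables (C : closedFieldType) (K : fieldType) (F : exp_diff_field C K).

(* A differential operator  sum_i P_i(x) d^i  is stored as the coefficient
   sequence {poly K} (only used as a container; no multiplication of
   polynomials is used for operators). *)
Definition applyop (P : {poly K}) (a : K) : K :=
  \sum_(i < size P) P`_i * iter i (D F) a.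

Definition ord_op (P : {poly K}) : nat := (size P).-1.

(* psi is a Darboux transform of e^{xz} with data f g P Q:
   psi = (1/f(z)) P e^{xz}  and  e^{xz} = (1/g(z)) Q psi,
   P, Q monic, f, g monic, ord P = deg f.  Here psi z := P e^{xz} / f(z),
   and the second identity is required for every z where it makes sense. *)
Definition psi_of (f : {poly C}) (P : {poly K}) (z : C) : K :=
  applyop P (Ex F z) / cst F f.[z].

Definition darboux (f g : {poly C}) (P Q : {poly K}) : Prop :=
  [/\ f \is monic, g \is monic, P \is monic & Q \is monic] /\
  ord_op P = (size f).-1 /\
      forall z : C, f.[z] != 0 -> g.[z] != 0 ->
        Ex F z = applyop Q (psi_of f P z) / cst F g.[z].

Definition rat_in_ex (a : K) : Prop :=
  exists p q : {poly C},
    (map_poly (cst F) q).[Ex F 1] != 0 /\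
    a = (map_poly (cst F) p).[Ex F 1] / (map_poly (cst F) q).[Ex F 1].

Definition trigonometric (P Q : {poly K}) : Prop :=
  (forall i, rat_in_ex P`_i) /\ (forall i, rat_in_ex Q`_i).

Definition lincomb (S : seq K) (c : nat -> C) : K :=
  \sum_(i < size S) cst F (c i) * S`_i.

Definition in_span (S : seq K) (a : K) : Prop :=
  exists c : nat -> C, a = lincomb S c.

Definition lin_indep (S : seq K) : Prop :=
  forall c : nat -> C, lincomb S c = 0 -> forall i, (i < size S)%N -> c i = 0.

Definition is_basis (V : K -> Prop) (S : seq K) : Prop :=
  [/\ uniq S, lin_indep S & forall a, V a <-> in_span S a].

End Defs.

Section Decomp.
Variables (C : closedFieldType) (K : fieldType) (F : exp_diff_field C K).
Variables (n : nat) (lam : 'I_n -> C) (nr : 'I_n -> nat) (m : 'I_n -> nat -> nat).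

Definition W_list (r : 'I_n) : seq K :=
  flatten [seq [seq X F ^+ k * Ex F (lam r - j%:R) | k <- iota 0 (m r j)]
          | j <- iota 0 (nr r).+1].

(* Phi_c(y) = sum_{j <= n_r} sum_{k < m_{r,j}} c_{k,j} y^k e^{(lam_r - j) x},
   as a polynomial in the auxiliary variable y with coefficients in K;
   c is indexed as c k j *)
Definition Phi (r : 'I_n) (c : nat -> nat -> C) : {poly K} :=
  \sum_(j < (nr r).+1) \sum_(k < m r j)
     (cst F (c k j) * Ex F (lam r - j%:R)) *: 'X^k.

Definition elem (r : 'I_n) (c : nat -> nat -> C) (l : nat) : K :=
  ((Phi r c)^`N(l)).[X F].

Definition l0 (r : 'I_n) (c : nat -> nat -> C) : nat :=
  (\max_(j < (nr r).+1) \max_(k < m r j | c k j != 0%R) k)%N.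

End Decomp.

(* Main.v *)
Require Import Defs.
From HB Require Import structures.
From Stdlib Require Import Classical_Prop.
From mathcomp Require Import all_boot all_order all_algebra ring zify.
Import Order.TTheory GRing.Theory Num.Theory.
Local Open Scope ring_scope.
Set Implicit Arguments. Unset Strict Implicit. Unset Printing Implicit Defensive.

(* Evaluate the space of polynomials v(s, y) at s = e^x, y = x and multiply by
   e^{mu x}: for exponents mu_r that are distinct modulo Z this is jointly
   injective, D becomes delta = mu + s d/ds + d/dy, and d/dy commutes with it.

   If P is trigonometric, clearing denominators turns it into an operator on
   each C[s, y] commuting with d/dy, so ker P (which lies in the sum of the W_r
   since QP = h(d)) splits along r into finite-dimensional subspaces stable
   under d/dy.  Such a subspace has a Jordan basis for d/dy: choose elements
   with linearly independent leading coefficients in y, greedily from the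
   highest y-degree down.

   Conversely, by Taylor expansion at y = x, P kills all the chain elements of
   v exactly when the polynomial sum_i P_i delta^i v in y vanishes.  This is a
   linear system over C[e^x] for the coefficients of P.  As dim ker P = ord P,
   the monic P is its only solution, so its coefficients are rational in e^x by
   Cramer's rule; those of Q follow from QP = h(d) by descending recursion. *)

(** * Differential operators *)

Section DiffField.
Variables (C : closedFieldType) (K : fieldType) (F : exp_diff_field C K).
Hypothesis char0 : [pchar C] =i pred0.

Lemma D_is_zmod_morphism : zmod_morphism (D F).
Proof.
move=> a b; have D0 : D F 0 = 0.
  by apply: (addrI (D F 0)); rewrite -D_add !addr0.
have DN c : D F (- c) = - D F c.
  by apply: (addrI (D F c)); rewrite -D_add !subrr.
by rewrite D_add DN.
Qed.

HB.instance Definition _ :=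
  GRing.isZmodMorphism.Build K K (D F) D_is_zmod_morphism.

Lemma D_cst c : D F (cst F c) = 0.
Proof. by apply/D_const; exists c. Qed.

Lemma D_cstM c a : D F (cst F c * a) = cst F c * D F a.
Proof. by rewrite D_mul D_cst mul0r add0r. Qed.

Lemma Ex_neq0 a : Ex F a != 0.
Proof.
apply/eqP => Ea0; have := oner_neq0 K.
by rewrite -(Ex0 F) -(subrr a) ExD Ea0 mul0r eqxx.
Qed.

Lemma Ex_nat n : Ex F n%:R = Ex F 1 ^+ n.
Proof. by elim: n => [|n IH]; rewrite ?Ex0 // -natr1 ExD IH exprSr. Qed.

Lemma natC_neq0 n : n.+1%:R != 0 :> C.
Proof. by rewrite ((pcharf0P C).1 char0). Qed.

Lemma natK_neq0 n : n.+1%:R != 0 :> K.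
Proof. by rewrite -(rmorph_nat (cst F)) fmorph_eq0 natC_neq0. Qed.

Lemma iterD_is_zmod i : zmod_morphism (iter i (D F)).
Proof. by elim: i => [|i IH] a b //=; rewrite IH raddfB. Qed.

HB.instance Definition _ i :=
  GRing.isZmodMorphism.Build K K (iter i (D F)) (iterD_is_zmod i).

Lemma iterD_cstM i c a : iter i (D F) (cst F c * a) = cst F c * iter i (D F) a.
Proof. by elim: i => //= i ->; rewrite D_cstM. Qed.

Lemma iterD_Ex i z : iter i (D F) (Ex F z) = cst F z ^+ i * Ex F z.
Proof.
elim: i => [|i /= ->]; first by rewrite expr0 mul1r.
by rewrite -rmorphXn D_cstM D_Ex exprSr rmorphXn mulrA.
Qed.

Lemma applyop_wide N (P : {poly K}) a : (size P <= N)%N ->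
  applyop F P a = \sum_(i < N) P`_i * iter i (D F) a.
Proof.
move=> leN; rewrite /applyop (big_ord_widen N (fun i => P`_i * iter i (D F) a)) //.
rewrite big_mkcond; apply: eq_bigr => i _; case: ltnP => // le.
by rewrite nth_default ?mul0r.
Qed.

Lemma applyop_is_zmod (P : {poly K}) : zmod_morphism (applyop F P).
Proof.
move=> a b; rewrite /applyop -sumrB; apply: eq_bigr => i _.
by rewrite raddfB mulrBr.
Qed.

HB.instance Definition _ P :=
  GRing.isZmodMorphism.Build K K (applyop F P) (applyop_is_zmod P).

Lemma applyop_cstM P c a : applyop F P (cst F c * a) = cst F c * applyop F P a.
Proof.
by rewrite /applyop mulr_sumr; apply: eq_bigr => i _; rewrite iterD_cstM mulrCA.
Qed.

(** Exponentials are eigenvectors of [D], so on them an operator acts through its symbol, the stored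
    polynomial evaluated at z. *)
Lemma applyop_Ex P z : applyop F P (Ex F z) = P.[cst F z] * Ex F z.
Proof.
rewrite horner_coef mulr_suml; apply: eq_bigr => i _.
by rewrite iterD_Ex mulrA.
Qed.

Lemma applyopD P1 P2 a : applyop F (P1 + P2) a = applyop F P1 a + applyop F P2 a.
Proof.
set N := maxn (size P1) (size P2).
rewrite (@applyop_wide N) ?(leq_trans (size_polyD _ _)) //.
rewrite (@applyop_wide N P1) ?leq_maxl // (@applyop_wide N P2) ?leq_maxr //.
by rewrite -big_split; apply: eq_bigr => i _; rewrite coefD mulrDl.
Qed.

Lemma applyopZ c P a : applyop F (c *: P) a = c * applyop F P a.
Proof.
rewrite (@applyop_wide (size P)) ?size_scale_leq // mulr_sumr.
by apply: eq_bigr => i _; rewrite coefZ mulrA.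
Qed.

Lemma applyop0 a : applyop F 0 a = 0.
Proof. by rewrite /applyop size_poly0 big_ord0. Qed.

Lemma applyopC c a : applyop F c%:P a = c * a.
Proof.
by rewrite (@applyop_wide 1) ?size_polyC_leq1 // big_ord1 coefC.
Qed.

Lemma applyop_sum (I : Type) (r : seq I) (p : I -> {poly K}) a :
  applyop F (\sum_(i <- r) p i) a = \sum_(i <- r) applyop F (p i) a.
Proof.
elim: r => [|i r IH]; first by rewrite !big_nil applyop0.
by rewrite !big_cons applyopD IH.
Qed.

(** The composite of d after [B], from the Leibniz rule d b = b d + b'. *)
Definition opD (B : {poly K}) : {poly K} := map_poly (D F) B + B * 'X.

Definition opcomp (A B : {poly K}) : {poly K} :=
  \sum_(i < size A) A`_i *: iter i opD B.

Lemma coef_opD B i : (opD B)`_i = D F B`_i + (if i is j.+1 then B`_j else 0).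
Proof. by rewrite coefD coef_map_id0 ?raddf0 // coefMX; case: i. Qed.

Lemma size_opD B : (size (opD B) <= (size B).+1)%N.
Proof.
apply/leq_sizeP => -[|j] // lt; rewrite coef_opD !nth_default ?raddf0 ?addr0 //.
by apply: leq_trans lt.
Qed.

Lemma applyop_opD B a : applyop F (opD B) a = D F (applyop F B a).
Proof.
rewrite (applyop_wide _ (size_opD B)) raddf_sum.
under eq_bigr do rewrite coef_opD mulrDl.
rewrite big_split /= big_ord_recr /= nth_default // raddf0 mul0r addr0.
rewrite big_ord_recl mul0r add0r -big_split; apply: eq_bigr => i _ /=.
by rewrite D_mul.
Qed.

Lemma applyop_comp A B a : applyop F (opcomp A B) a = applyop F A (applyop F B a).
Proof.
rewrite applyop_sum; apply: eq_bigr => i _; rewrite applyopZ; congr (_ * _).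
by elim: (nat_of_ord i) => //= j IH; rewrite applyop_opD IH.
Qed.

Lemma size_iter_opD i B : (size (iter i opD B) <= size B + i)%N.
Proof.
elim: i => [|i IH] /=; first by rewrite addn0.
by apply: leq_trans (size_opD _) _; rewrite addnS ltnS.
Qed.

(** Differentiating coefficients never raises the order, so each factor d only shifts the top
    coefficient. *)
Lemma lead_iter_opD i B : (iter i opD B)`_((size B).-1 + i) = lead_coef B.
Proof.
elim: i => [|i IH] /=; first by rewrite addn0.
rewrite addnS coef_opD IH nth_default ?raddf0 ?add0r //.
by apply: leq_trans (size_iter_opD _ _) _; rewrite -addSn leq_add2r leqSpred.
Qed.

End DiffField.

(** * Linear independence over the constants *)

Section Span.
Variables (C : closedFieldType) (K : fieldType) (F : exp_diff_field C K).
Hypothesis char0 : [pchar C] =i pred0.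

Lemma lincomb_cons u S c :
  lincomb F (u :: S) c = cst F (c 0) * u + lincomb F S (fun i => c i.+1).
Proof. by rewrite /lincomb big_ord_recl. Qed.

Lemma lincomb_nil c : lincomb F [::] c = 0.
Proof. by rewrite /lincomb big_ord0. Qed.

Lemma in_span_cons u S a :
  in_span F (u :: S) a <-> exists c b, in_span F S b /\ a = cst F c * u + b.
Proof.
split=> [[c ->] | [c [b [[d ->] ->]]]].
  by exists (c 0), (lincomb F S (fun i => c i.+1)); rewrite lincomb_cons;
    split=> //; exists (fun i => c i.+1).
by exists (fun i => if i is j.+1 then d j else c); rewrite lincomb_cons.
Qed.

Lemma in_span_nil a : in_span F [::] a <-> a = 0.
Proof.
by split=> [[c ->]|->]; [rewrite lincomb_nil | exists (fun=> 0); rewrite lincomb_nil].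
Qed.

Lemma in_span0 S : in_span F S 0.
Proof.
exists (fun=> 0); rewrite /lincomb big1 // => i _.
by rewrite rmorph0 mul0r.
Qed.

Lemma in_spanP S c a b : in_span F S a -> in_span F S b ->
  in_span F S (cst F c * a + b).
Proof.
move=> [d ->] [e ->]; exists (fun i => c * d i + e i).
rewrite /lincomb mulr_sumr -big_split; apply: eq_bigr => i _ /=.
by rewrite rmorphD rmorphM mulrDl mulrA.
Qed.

Lemma in_spanZ S c a : in_span F S a -> in_span F S (cst F c * a).
Proof. by move=> h; rewrite -[_ * _]addr0; apply: in_spanP => //; apply: in_span0. Qed.

Lemma in_spanD S a b : in_span F S a -> in_span F S b -> in_span F S (a + b).
Proof. by move=> ha hb; rewrite -[a]mul1r -(rmorph1 (cst F)); apply: in_spanP. Qed.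

Lemma in_spanN S a : in_span F S a -> in_span F S (- a).
Proof. by move=> ha; rewrite -mulN1r -(rmorphN1 (cst F)); apply: in_spanZ. Qed.

Lemma in_span_sum S (I : Type) (r : seq I) (p : pred I) (a : I -> K) :
  (forall i, p i -> in_span F S (a i)) -> in_span F S (\sum_(i <- r | p i) a i).
Proof.
move=> h; elim/big_rec: _ => [|i x pi hx]; first exact: in_span0.
by apply: in_spanD => //; apply: h.
Qed.

Lemma in_span_mem S a : a \in S -> in_span F S a.
Proof.
elim: S => // u S IH; rewrite inE => /orP[/eqP ->|/IH h]; apply/in_span_cons.
  by exists 1, 0; rewrite rmorph1 mul1r addr0; split=> //; apply: in_span0.
by exists 0, a; rewrite rmorph0 mul0r add0r.
Qed.

Lemma in_span_closed (V : K -> Prop) S a : V 0 ->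
  (forall c x y, V x -> V y -> V (cst F c * x + y)) ->
  (forall u, u \in S -> V u) -> in_span F S a -> V a.
Proof.
move=> V0 VP; elim: S a => [|u S IH] a VS; first by move/in_span_nil=> ->.
move/in_span_cons=> [c [b [hb ->]]]; apply: VP; first by apply: VS; rewrite mem_head.
by apply: IH hb => v vS; apply: VS; rewrite inE vS orbT.
Qed.

Lemma lin_indep_cons u S :
  lin_indep F (u :: S) <-> lin_indep F S /\ ~ in_span F S u.
Proof.
split=> [h | [hS hu] c].
  split=> [c cS i iS | [c uE]].
    pose d i := if i is j.+1 then c j else 0.
    by apply: (h d _ i.+1); rewrite // lincomb_cons rmorph0 mul0r add0r.
  pose d i := if i is j.+1 then c j else -1.
  have d0 : lincomb F (u :: S) d = 0
    by rewrite lincomb_cons /= rmorphN1 mulN1r -uE addNr.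
  by have /eqP := h d d0 0 isT; rewrite oppr_eq0 oner_eq0.
rewrite lincomb_cons; have [c0 | c0] := eqVneq (c 0) 0.
  rewrite c0 rmorph0 mul0r add0r => /hS h [|i] //; exact: h.
move/eqP; rewrite addr_eq0 => /eqP e; case: hu; exists (fun i => - (c 0)^-1 * c i.+1).
have c0K : cst F (c 0) != 0 by rewrite fmorph_eq0.
apply: (mulfI c0K); rewrite e.
rewrite /lincomb -sumrN mulr_sumr; apply: eq_bigr => i _.
by rewrite mulrA -rmorphM mulNr mulrN mulrA divff // mul1r rmorphN mulNr.
Qed.

Lemma lin_indep_uniq S : lin_indep F S -> uniq S.
Proof.
elim: S => // u S IH /lin_indep_cons [hS hu] /=; rewrite IH // andbT.
by apply/negP => /in_span_mem.
Qed.

Lemma lincomb_family (T : finType) (w : T -> K) (c : nat -> C) :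
  lincomb F [seq w t | t <- enum T] c =
  \sum_t cst F (c (enum_rank t)) * w t.
Proof.
rewrite /lincomb size_map -cardT (reindex (@enum_rank T)) /=; last first.
  by exists enum_val => t _; rewrite ?enum_rankK ?enum_valK.
apply: eq_bigr => t _; rewrite (nth_map t) -?cardT //.
by rewrite nth_enum_rank.
Qed.

(** The bases below are indexed by dependent pairs; this indexes coefficients the same way instead
    of by position. *)
Lemma lin_indep_family (T : finType) (w : T -> K) :
  (forall c : T -> C, \sum_t cst F (c t) * w t = 0 -> forall t, c t = 0) ->
  lin_indep F [seq w t | t <- enum T].
Proof.
move=> h c; rewrite lincomb_family => /h h' i; rewrite size_map -cardT => lt.
by rewrite -(h' (enum_val (Ordinal lt))) enum_valK.
Qed.

Lemma natK_inj : injective (fun n : nat => cst F n%:R).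
Proof.
move=> i j /(fmorph_inj (cst F)) /eqP; wlog le: i j / (i <= j)%N.
  by move=> h; case/orP: (leq_total i j) => /h // h'; rewrite eq_sym => /h'.
by rewrite -subr_eq0 -oppr_eq0 opprB -natrB // ((pcharf0P C).1 char0) subn_eq0 =>
  le'; apply/eqP; rewrite eqn_leq le.
Qed.

Lemma poly_eq0_nat (p : {poly K}) : (forall n : nat, root p (cst F n%:R)) -> p = 0.
Proof.
move=> h; apply/eqP/negP => /negP p0.
have := max_poly_roots p0 (rs := [seq cst F n%:R | n <- iota 0 (size p)]).
rewrite size_map size_iota ltnn map_inj_uniq ?iota_uniq; last exact: natK_inj.
by move/(_ _ isT)/notF; apply; apply/allP => _ /mapP[n _ ->]; apply: h.
Qed.

(** Tested on e^{nx}, the symbol vanishes at every natural number, hence identically in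
    characteristic 0. *)
Lemma applyop_inj0 A : (forall a, applyop F A a = 0) -> A = 0.
Proof.
move=> h; apply: poly_eq0_nat => n; have /eqP := h (Ex F n%:R).
by rewrite applyop_Ex mulf_eq0 (negPf (Ex_neq0 _ _)) orbF.
Qed.

Lemma right_division1 (b : K) (A : {poly K}) : exists (A' : {poly K}) (r : K),
  (size A' <= (size A).-1)%N /\
  forall a, applyop F A a = applyop F A' (D F a - b * a) + r * a.
Proof.
have div_iter i : exists (B : {poly K}) (r : K), (size B <= i)%N /\
    forall a, iter i (D F) a = applyop F B (D F a - b * a) + r * a.
  elim: i => [|i [B [r [sB hB]]]].
    by exists 0, 1; rewrite size_poly0; split=> // a; rewrite applyop0 add0r mul1r.
  (* With y = D a - b a, D (r a) = r y + (D r + r b) a: the quotient gains the constant term r. *)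
  exists (opD F B + r%:P), (D F r + r * b); split=> [|a].
    rewrite (leq_trans (size_polyD _ _)) // geq_max (leq_trans (size_opD _ _)) //.
    by rewrite (leq_trans (size_polyC_leq1 _)).
  by rewrite /= hB D_add D_mul applyopD applyop_opD applyopC; ring.
have /fin_all_exists [B hB] : forall i : 'I_(size A), exists B : {poly K}, exists r : K,
    (size B <= i)%N /\ forall a, iter i (D F) a = applyop F B (D F a - b * a) + r * a.
  by move=> i; apply: div_iter.
have /fin_all_exists [r hr] := hB.
exists (\sum_(i < size A) A`_i *: B i), (\sum_(i < size A) A`_i * r i); split=> [|a].
  apply: (big_ind (fun p : {poly K} => (size p <= (size A).-1)%N)) => [|p q hp hq|i _].
  - by rewrite size_poly0.
  - by rewrite (leq_trans (size_polyD _ _)) // geq_max hp.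
  rewrite (leq_trans (size_scale_leq _ _)) // (leq_trans (hr i).1) //.
  by rewrite -ltnS (leq_trans (ltn_ord i)) // leqSpred.
rewrite {1}/applyop applyop_sum mulr_suml -big_split.
by apply: eq_bigr => i _; rewrite (hr i).2 applyopZ mulrDr mulrA.
Qed.

(* Reduction of order: dividing on the right by [d - u'/u], whose kernel is
   spanned by the first solution [u], removes [u] from the list. *)
Lemma lin_indep_ker_size A S : A != 0 -> lin_indep F S ->
  (forall u, u \in S -> applyop F A u = 0) -> (size S < size A)%N.
Proof.
move: {2}(size S) (erefl (size S)) => n.
elim: n S A => [|n IH] [|u S] A //= sSn A0 iS hS; first by rewrite size_poly_gt0.
case: sSn => sSn.
have u0 : u != 0.
  apply: contra_notN (((lin_indep_cons u S).1 iS).2) => /eqP ->; exact: in_span0.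
have [A' [r [sA' hA']]] := right_division1 (D F u / u) A.
have r0 : r = 0.
  have := hA' u; rewrite hS ?mem_head // divfK // subrr raddf0 add0r => /esym/eqP.
  by rewrite mulf_eq0 (negPf u0) orbF => /eqP.
have A'0 : A' != 0.
  apply: contra_neq A0 => A'0; apply: applyop_inj0 => a.
  by rewrite hA' A'0 r0 applyop0 mul0r addr0.
pose T a := D F a - D F u / u * a.
suff: (size [seq T v | v <- S] < size A')%N.
  by rewrite size_map => /leq_trans/(_ sA'); case: (size A).
have TP c : lincomb F [seq T v | v <- S] c = T (lincomb F S c).
  rewrite /lincomb size_map /T raddf_sum mulr_sumr -sumrB.
  by apply: eq_bigr => i _; rewrite (nth_map 0) //= D_cstM mulrBr [in RHS]mulrCA.
apply: IH => // [|c|v].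
- by rewrite size_map.
- rewrite TP /T; set y := lincomb F S c => Ty i; rewrite size_map => iS'.
  (* T y = u (y/u)', so T y = 0 gives y = d u with d constant; independence of [u :: S] makes this
     relation trivial. *)
  have /D_const [d yd] : D F (y / u) = 0.
    have e : D F y = D F (y / u) * u + y / u * D F u by rewrite -D_mul divfK.
    by apply: (mulIf u0); rewrite mul0r -Ty e; ring.
  pose e i := if i is j.+1 then c j else - d.
  apply: (iS e _ i.+1) => //; rewrite lincomb_cons /= -/y rmorphN -yd.
  by rewrite mulNr divfK // addNr.
- case/mapP=> x xS ->; have := hA' x; rewrite r0 mul0r addr0 => <-.
by apply: hS; rewrite inE xS orbT.
Qed.

Lemma op_eq0_of_ker (A : {poly K}) S : lin_indep F S -> (size A <= size S)%N ->
  (forall u, u \in S -> applyop F A u = 0) -> A = 0.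
Proof.
move=> iS sA hA; apply/eqP/negP => /negP A0.
by have := lin_indep_ker_size A0 iS hA; rewrite ltnNge sA.
Qed.

(** Induction on [S]: if P u lies in the span of the images of [S2], subtracting a suitable x from u
    gives a new kernel element; otherwise u joins [S2]. *)
Lemma rank_nullity (P : {poly K}) S : lin_indep F S ->
  exists S1 S2, [/\ lin_indep F S1, (forall u, u \in S1 ->
    in_span F S u /\ applyop F P u = 0),
    (forall u, u \in S2 -> u \in S),
    lin_indep F [seq applyop F P u | u <- S2] & size S = (size S1 + size S2)%N].
Proof.
elim: S => [_|u S IH /lin_indep_cons [iS uS]]; first by exists [::], [::].
have [S1 [S2 [i1 h1 h2 i2 sS]]] := IH iS.
have sub v : in_span F S v -> in_span F (u :: S) v.
  by move=> h; apply/in_span_cons; exists 0, v; rewrite rmorph0 mul0r add0r.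
case: (classic (in_span F [seq applyop F P u | u <- S2] (applyop F P u))) => hPu.
  have [x [xS Px]] : exists x, in_span F S x /\ applyop F P u = applyop F P x.
    pose V z := exists x, in_span F S x /\ z = applyop F P x.
    apply: (in_span_closed (V :=
      V)) hPu => [|c x y [x' [hx ->]] [y' [hy ->]]|_ /mapP[z /h2 zS ->]].
    - by exists 0; rewrite raddf0; split=> //; apply: in_span0.
    - exists (cst F c * x' + y'); split; first exact: in_spanP.
      by rewrite raddfD /= applyop_cstM.
    - by exists z; split=> //; apply: in_span_mem.
  exists (u - x :: S1), S2; split=> //.
  - apply/lin_indep_cons; split=> // h; apply: uS.
    rewrite -(subrK x u); apply: in_spanD => //.
    apply: (in_span_closed (V := in_span F S)) h => [|c a b|v /h1 []//].
      exact: in_span0.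
    exact: in_spanP.
  - move=> v; rewrite inE => /orP[/eqP ->|/h1 [hv ->]]; last by split=> //; apply: sub.
    rewrite raddfB /= Px subrr; split=> //.
    by apply: in_spanD; [apply: in_span_mem; rewrite mem_head | apply/in_spanN/sub].
  - by move=> v /h2; rewrite inE orbC => ->.
  - by rewrite /= sS addSn.
exists S1, (u :: S2); split=> //.
- by move=> v /h1 [hv ->]; split=> //; apply: sub.
- move=> v; rewrite !inE => /orP[->//|/h2 ->]; exact: orbT.
- exact/lin_indep_cons.
- by rewrite /= sS addnS.
Qed.

End Span.

(** * Exponential polynomials *)

Section ExpPoly.
Variables (C : closedFieldType) (K : fieldType) (F : exp_diff_field C K).
Hypothesis char0 : [pchar C] =i pred0.

(** Substitution s = e^x, a ring morphism from C[s] to [K]. *)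
Definition expx : {poly C} -> K := horner_eval (Ex F 1) \o map_poly (cst F).

HB.instance Definition _ :=
  GRing.RMorphism.copy expx (horner_eval (Ex F 1) \o map_poly (cst F)).

Lemma expxE p : expx p = (map_poly (cst F) p).[Ex F 1].
Proof. by []. Qed.

Lemma expxC c : expx c%:P = cst F c.
Proof. by rewrite expxE map_polyC hornerC. Qed.

Lemma expxXn i : expx 'X^i = Ex F i%:R.
Proof. by rewrite expxE map_polyXn hornerXn Ex_nat. Qed.

Lemma D_horner (p : {poly K}) u :
  D F p.[u] = (map_poly (D F) p).[u] + p^`().[u] * D F u.
Proof.
elim/poly_ind: p => [|p c IH].
  by rewrite raddf0 derivC !horner0 raddf0 mul0r addr0.
have -> : map_poly (D F) (p * 'X + c%:P) = map_poly (D F) p * 'X + (D F c)%:P.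
  apply/polyP=> -[|i]; rewrite coef_map /= !coefD !coefMX !coefC ?addr0 ?add0r //=.
  by rewrite coef_map.
rewrite derivD derivM derivX derivC addr0 mulr1 !hornerE D_add D_mul IH; ring.
Qed.

Lemma D_horner_cst (p : {poly C}) u :
  D F (map_poly (cst F) p).[u] = (map_poly (cst F) p^`()).[u] * D F u.
Proof.
rewrite D_horner deriv_map (_ : map_poly (D F) _ = 0) ?horner0 ?add0r //.
by apply/polyP=> i; rewrite !coef_map /= D_cst coef0.
Qed.

(** The Euler derivation s d/ds, which [expx] carries to [D]. *)
Definition theta (p : {poly C}) : {poly C} := 'X * p^`().

Lemma theta_is_zmod : zmod_morphism theta.
Proof. by move=> p q; rewrite /theta derivB mulrBr. Qed.

HB.instance Definition _ :=
  GRing.isZmodMorphism.Build {poly C} {poly C} theta theta_is_zmod.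

Lemma D_expx p : D F (expx p) = expx (theta p).
Proof.
have X1 : expx 'X = Ex F 1 by rewrite -['X]expr1 expxXn.
by rewrite /theta rmorphM /= X1 !expxE D_horner_cst D_Ex rmorph1 mul1r mulrC.
Qed.

(** Here [v] lies in C[s][y], with y the outer variable and s the inner one. *)
Definition expoly (mu : C) (v : {poly {poly C}}) : K :=
  Ex F mu * (map_poly expx v).[X F].

Lemma expoly_is_zmod mu : zmod_morphism (expoly mu).
Proof. by move=> u v; rewrite /expoly rmorphB hornerD hornerN mulrBr. Qed.

HB.instance Definition _ mu :=
  GRing.isZmodMorphism.Build {poly {poly C}} K (expoly mu) (expoly_is_zmod mu).

Lemma expolyZ mu p v : expoly mu (p *: v) = expx p * expoly mu v.
Proof. by rewrite /expoly map_polyZ hornerZ mulrCA. Qed.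

Definition delta (mu : C) (v : {poly {poly C}}) : {poly {poly C}} :=
  mu%:P *: v + map_poly theta v + v^`().

Lemma coef_delta mu v k : (delta mu v)`_k = mu%:P * v`_k + theta v`_k + v`_k.+1 *+ k.+1.
Proof. by rewrite !coefD coefZ coef_map coef_deriv. Qed.

Lemma D_expoly mu v : D F (expoly mu v) = expoly mu (delta mu v).
Proof.
have e1 : map_poly (D F) (map_poly expx v) = map_poly expx (map_poly theta v).
  by apply/polyP=> i; rewrite !coef_map /= D_expx.
rewrite /expoly D_mul D_Ex D_horner D_X mulr1 e1 deriv_map /delta !rmorphD /=
  map_polyZ /=.
by rewrite !hornerD hornerZ expxC; ring.
Qed.

Lemma iterD_expoly i mu v :
  iter i (D F) (expoly mu v) = expoly mu (iter i (delta mu) v).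
Proof. by elim: i => //= i ->; rewrite D_expoly. Qed.

(** The part mu + s d/ds of [delta mu] acts only on the coefficients of the powers of y. *)
Lemma delta_deriv mu v : (delta mu v)^`() = delta mu v^`().
Proof.
apply/polyP=> k; rewrite coef_deriv !coef_delta !coef_deriv raddfMn /=.
by rewrite mulrnDl mulrnDl mulrnAr -!mulrnA [in X in _ + X]mulnC.
Qed.

Lemma iter_delta_derivn i l mu v :
  (iter i (delta mu) v)^`(l) = iter i (delta mu) v^`(l).
Proof.
elim: l => [|l IH]; rewrite ?derivn0 // !derivnS IH.
by elim: i {IH} => //= i <-; rewrite delta_deriv.
Qed.

Lemma size_delta mu v : (size (delta mu v) <= size v)%N.
Proof.
apply/leq_sizeP => k le;
  rewrite coef_delta !nth_default ?raddf0 ?mulr0 ?mul0rn ?addr0 //.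
exact: leq_trans le _.
Qed.

Lemma size_iter_delta i mu v : (size (iter i (delta mu) v) <= size v)%N.
Proof. by elim: i => //= i IH; apply: leq_trans (size_delta _ _) IH. Qed.

(** Induction on the total size of the family. If p t is nonzero, D - e t shortens p t and lengthens
    no other member, so the new family is zero; as the exponents differ, every other p s is zero and
    p t is constant. *)
Lemma expoly_indep (T : finType) (e : T -> C) (p : T -> {poly C}) : injective e ->
  \sum_t (map_poly (cst F) (p t)).[X F] * Ex F (e t) = 0 -> forall t, p t = 0.
Proof.
move=> inj_e; have [m] := ubnP (\sum_t size (p t)); elim: m p => // m IH p lt_m sum0.
(* [q a] is the family obtained by applying D - a to the sum. *)
pose q a t := (p t)^`() + (e t - a)%:P * p t.
have qE a t : (map_poly (cst F) (q a t)).[X F] * Ex F (e t) =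
    D F ((map_poly (cst F) (p t)).[X F] * Ex F (e t)) -
    cst F a * ((map_poly (cst F) (p t)).[X F] * Ex F (e t)).
  rewrite D_mul D_horner_cst D_X D_Ex /q rmorphD rmorphM /= map_polyC /=.
  by rewrite hornerD hornerM hornerC rmorphB /=; ring.
have sq a t : (size (q a t) <= size (p t))%N.
  rewrite (leq_trans (size_polyD _ _)) // geq_max (leq_trans (size_poly _ _))
    ?leq_pred //.
  by rewrite mul_polyC size_scale_leq.
have q0 t : p t != 0 -> forall s, q (e t) s = 0.
  move=> pt0; apply: IH; last first.
    under eq_bigr do rewrite qE.
    by rewrite sumrB -raddf_sum -mulr_sumr sum0 raddf0 mulr0 subrr.
  apply: (@leq_trans (\sum_t size (p t))%N); last by rewrite -ltnS.
  rewrite (bigD1 t) //= [X in (_ <= X)%N](bigD1 t) //= -addSn leq_add ?leq_sum //.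
  by rewrite /q subrr mul0r addr0 lt_size_deriv.
move=> t; apply/eqP/negP => /negP pt0.
have p0 s : s != t -> p s = 0.
  move=> st; apply/eqP; rewrite -[_ == _]negbK; apply/negP => ps0.
  (* At the degree of p s, the coefficient of q (e t) s is e s - e t times the leading coefficient
     of p s. *)
  have /(congr1 (fun r : {poly C} => r`_(size (p s)).-1)) := q0 t pt0 s.
  rewrite /q coefD coef_deriv coefCM prednK ?size_poly_gt0 //.
  rewrite [_`_(size _)]nth_default //.
  rewrite mul0rn add0r coef0 => /eqP;
    rewrite mulf_eq0 subr_eq0 (inj_eq inj_e) (negPf st) /=.
  by rewrite -lead_coefE lead_coef_eq0 (negPf ps0).
have := q0 t pt0 t; rewrite /q subrr mul0r addr0 => dp0.
have /size1_polyC pC : (size (p t) <= 1)%N.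
  apply/leq_sizeP => -[|k] // _; have := congr1 (fun r : {poly C} => r`_k) dp0.
  rewrite coef_deriv coef0 -mulr_natr => /eqP;
    rewrite mulf_eq0 (negPf (natC_neq0 char0 k)) orbF.
  by move/eqP.
move: sum0; rewrite (bigD1 t) //= big1 => [|s /p0 ->]; last
  by rewrite rmorph0 horner0 mul0r.
rewrite addr0 pC map_polyC hornerC => /eqP.
rewrite mulf_eq0 (negPf (Ex_neq0 _ _)) orbF fmorph_eq0 -polyC_eq0 -pC.
by rewrite (negPf pt0).
Qed.

(** Expansion in powers of s: s^i moves the exponent to mu + i, and [swapXY] collects its
    coefficient as a polynomial in y. *)
Lemma expoly_swapXY M mu v : (size (swapXY v) <= M)%N ->
  expoly mu v = \sum_(i < M) (map_poly (cst F) (swapXY v)`_i).[X F] * Ex F (mu + i%:R).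
Proof.
move=> sM; set N := maxn (size v) (\max_(i < M) size ((swapXY v)`_i)%R)%N.
rewrite /expoly (@horner_coef_wide _ N); last first.
  by rewrite (leq_trans (size_poly _ _)) // leq_maxl.
transitivity (\sum_(k < N) \sum_(i < M) cst F v`_k`_i * X F ^+ k * Ex F (mu + i%:R)).
  rewrite mulr_sumr; apply: eq_bigr => k _;
    rewrite coef_map /= expxE (@horner_coef_wide _ M).
    rewrite mulr_suml mulr_sumr; apply: eq_bigr => i _.
    by rewrite coef_map ExD Ex_nat /=; ring.
  rewrite (leq_trans (size_poly _ _)) //; apply/leq_sizeP => i le.
  by rewrite -coef_swapXY [(swapXY v)`_i]nth_default ?coef0 // (leq_trans sM).
rewrite exchange_big; apply: eq_bigr => i _ /=; rewrite (@horner_coef_wide _ N).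
  by rewrite mulr_suml; apply: eq_bigr => k _; rewrite coef_map coef_swapXY.
rewrite (leq_trans (size_poly _ _)) // (leq_trans _ (leq_maxr _ _)) //.
exact: (leq_bigmax (F := fun i : 'I_M => size (swapXY v)`_i)).
Qed.

(** The exponents mu r + i are pairwise distinct because the mu r differ by no integer, so
    exponential polynomials with these exponents are independent. *)
Lemma expoly_sum_eq0 n (mu : 'I_n -> C) (v : 'I_n -> {poly {poly C}}) :
  (forall r s, r != s -> forall k : int, mu r - mu s != k%:~R) ->
  \sum_r expoly (mu r) (v r) = 0 -> forall r, v r = 0.
Proof.
move=> nZ sum0; set M := (\max_r size (swapXY (v r)))%N.
have le_M r : (size (swapXY (v r)) <= M)%N by exact: (leq_bigmax (F :=
  fun r => size (swapXY (v r)))).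
have inj_e : injective (fun t : 'I_n * 'I_M => mu t.1 + (t.2)%:R).
  move=> [r i] [s j] /= e.
  have rs : r = s.
    apply/eqP/negP => /negP /nZ /(_ (j%:Z - i%:Z)) /negP; apply; apply/eqP.
    have -> : mu r = mu s + j%:R - i%:R by rewrite -e addrK.
    by rewrite rmorphB /= -!pmulrn; ring.
  congr (_, _) => //; rewrite rs in e; apply/val_inj/(natK_inj (F := F) char0).
  by congr (cst F _); apply: addrI e.
have := expoly_indep (p := fun t : 'I_n * 'I_M => (swapXY (v t.1))`_t.2) inj_e.
rewrite -(pair_bigA _ (fun (r : 'I_n) (i : 'I_M) => (map_poly (cst F) (swapXY (v
  r))`_i).[X F] * Ex F (mu r + i%:R))) /=.
under eq_bigr do rewrite -expoly_swapXY //.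
move/(_ sum0) => h r; apply: (can_inj swapXYK); rewrite linear0; apply/polyP=> i.
have [lt | le] := ltnP i M; last by rewrite coef0 nth_default // (leq_trans (le_M r)).
by rewrite coef0 (h (r, Ordinal lt)).
Qed.

Lemma expoly_eq0 mu v : expoly mu v = 0 -> v = 0.
Proof.
move=> v0; apply: (@expoly_sum_eq0 1 (fun=> mu) (fun=> v) _ _ ord0); last
  by rewrite big_ord1.
by move=> r s; rewrite !ord1.
Qed.

(** Taylor expansion at x in characteristic 0: by induction R' = 0, so R is the constant R(x) =
    0. *)
Lemma poly_eq0_derivn (R : {poly K}) x : (forall l, R^`(l).[x] = 0) -> R = 0.
Proof.
have [m] := ubnP (size R); elim: m R => // m IH R lt h.
have [->//|R0] := eqVneq R 0.
have dR0 : R^`() = 0.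
  apply: IH => [|l]; last by rewrite -derivSn h.
  by rewrite -ltnS (leq_trans _ lt) // ltnS lt_size_deriv.
have RC : R = (R`_0)%:P.
  apply: size1_polyC; apply/leq_sizeP => -[|k] // _.
  have := congr1 (fun r : {poly K} => r`_k) dR0.
  rewrite coef_deriv coef0 -mulr_natr => /eqP; rewrite mulf_eq0.
  by rewrite (negPf (natK_neq0 F char0 k)) orbF => /eqP.
by have := h 0; rewrite derivn0 RC hornerC => ->.
Qed.

End ExpPoly.

(** * The factorization QP = h(d) *)

Section Factor.
Variables (C : closedFieldType) (K : fieldType) (F : exp_diff_field C K).
Hypothesis char0 : [pchar C] =i pred0.

Notation cop h := (map_poly (cst F) h).

(** Constants commute with d, so here the product of stored polynomials is the composite of
    operators. *)
Lemma applyop_copM (g h : {poly C}) a :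
  applyop F (cop (g * h)) a = applyop F (cop g) (applyop F (cop h) a).
Proof.
have it i : iter i (opD F) (cop h) = cop h * 'X^i.
  elim: i => [|i /= ->]; first by rewrite mulr1.
  rewrite /opD (_ : map_poly _ _ = 0) ?add0r ?exprSr ?mulrA //.
  apply/polyP=> j; rewrite coef_map_id0 ?raddf0 // coef0 coefMXn.
  by case: ifP; rewrite ?raddf0 // coef_map D_cst.
rewrite -applyop_comp; congr (applyop F _ a); rewrite /opcomp.
under eq_bigr do rewrite it scalerAr.
by rewrite -mulr_sumr -poly_def coefK rmorphM mulrC.
Qed.

(** Conjugation by e^{ax} turns d - a into d. *)
Lemma applyop_XsubC_exp (a : C) (p : {poly C}) k :
  applyop F (cop (('X - a%:P) ^+ k)) ((cop p).[X F] * Ex F a) =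
  (cop p^`(k)).[X F] * Ex F a.
Proof.
elim: k => [|k IH]; first by rewrite expr0 rmorph1 applyopC mul1r derivn0.
rewrite exprS applyop_copM IH derivnS.
rewrite rmorphB /= map_polyX map_polyC (@applyop_wide _ _ _ 2) ?size_XsubC //.
rewrite big_ord_recl big_ord1 /= !coefB !coefX !coefC /= subr0 mul1r sub0r.
by rewrite D_mul D_horner_cst D_X D_Ex; ring.
Qed.

Lemma applyop_cop_monomial h (a : C) k :
  ('X - a%:P) ^+ k.+1 %| h -> applyop F (cop h) (X F ^+ k * Ex F a) = 0.
Proof.
case/dvdpP=> q ->; rewrite applyop_copM.
have -> : X F ^+ k = (cop 'X^k).[X F] by rewrite map_polyXn hornerXn.
by rewrite applyop_XsubC_exp derivn_poly0 ?size_polyXn // rmorph0 horner0 mul0r raddf0.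
Qed.

(** Both operators agree on e^{nx} for every natural n outside the zeros of f g. *)
Lemma opcomp_darboux f g P Q :
  darboux F f g P Q -> opcomp F Q P = cop (f * g).
Proof.
move=> [[mf mg _ _] [_ dar]].
have h0 : cop (f * g) != 0 by rewrite map_poly_eq0 mulf_neq0 ?monic_neq0.
(* The extra factor vanishes at the zeros of f g, where the Darboux identity says nothing. *)
apply/eqP; rewrite -subr_eq0; apply/eqP; apply: (mulIf h0); rewrite mul0r.
apply: (poly_eq0_nat (F := F) char0) => n; set z := n%:R.
rewrite /root hornerM mulf_eq0 horner_map fmorph_eq0 hornerM mulf_eq0.
have [_|fz] := eqVneq f.[z] 0; first by rewrite orbT.
have [_|gz] := eqVneq g.[z] 0; first by rewrite !orbT.
rewrite !orbF; apply/eqP/(mulIf (Ex_neq0 F z)); rewrite mul0r hornerD hornerN mulrBl.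
rewrite -applyop_Ex applyop_comp horner_map hornerM rmorphM {2}(dar z fz gz) /psi_of.
rewrite [_ / cst F f.[z]]mulrC -fmorphV applyop_cstM mulrA mulrC.
by rewrite fmorphV -!mulrA; field; rewrite !fmorph_eq0 fz gz.
Qed.

(** The coefficient of d^(ord Q + ord P) is the leading coefficient of Q: P is monic, and the terms
    Q_i d^i P with i below ord Q have lower order. *)
Lemma size_opcomp (P Q : {poly K}) : P \is monic -> Q != 0 ->
  ((size Q).-1 + (size P).-1 < size (opcomp F Q P))%N.
Proof.
move=> mP Q0; have sQ : (0 < size Q)%N by rewrite size_poly_gt0.
have lt : ((size Q).-1 < size Q)%N by rewrite prednK.
rewrite ltnNge; apply: contra Q0 => /leq_sizeP/(_ _ (leqnn _)).
rewrite /opcomp coef_sum (bigD1 (Ordinal lt)) //=.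
rewrite coefZ [((size Q).-1 + _)%N]addnC lead_iter_opD (eqP mP) mulr1.
rewrite big1 ?addr0 => [|i]; first by move/eqP; rewrite -lead_coefE lead_coef_eq0.
rewrite -val_eqE /= => ne; rewrite coefZ [X in _ * X]nth_default ?mulr0 //.
apply: leq_trans (size_iter_opD _ _ _) _.
have iQ : (i < (size Q).-1)%N by rewrite ltn_neqAle ne -ltnS (prednK sQ) ltn_ord.
rewrite -(prednK (_ : 0 < size P)%N) ?size_poly_gt0 ?monic_neq0 //= addSn -addnS
  leq_add2l //.
Qed.

(** P maps [S2] to independent solutions of Q, at most ord Q of them, so at least ord QP - ord Q >=
    ord P elements are left for [S1]. *)
Lemma full_kernel (P Q : {poly K}) S : P \is monic -> Q != 0 -> lin_indep F S ->
  (size S).+1 = size (opcomp F Q P) ->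
  (forall u, u \in S -> applyop F (opcomp F Q P) u = 0) ->
  exists S1, [/\ lin_indep F S1, (forall u, u \in S1 -> applyop F P u = 0) &
     ((size P).-1 <= size S1)%N].
Proof.
move=> mP Q0 iS sS kS; have [S1 [S2 [i1 h1 h2 i2 sS12]]] := rank_nullity P iS.
exists S1; split=> // [u /h1[]//|].
have lt2 : (size S2 < size Q)%N.
  rewrite -(size_map (applyop F P));
    apply: (lin_indep_ker_size char0 Q0 i2) => _ /mapP[u /h2 uS ->].
  by rewrite -applyop_comp kS.
have := size_opcomp mP Q0; rewrite -sS sS12 ltnS => le.
rewrite -(leq_add2l (size Q).-1) (leq_trans le) // addnC leq_add2r.
by rewrite -ltnS prednK // (leq_trans _ lt2).
Qed.

(** * The kernel of h(d) *)

Section Kernel.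
Variables (n : nat) (lam : 'I_n -> C) (nr : 'I_n -> nat) (m : 'I_n -> nat -> nat).
Hypothesis lamZ : forall r s : 'I_n, r != s -> forall k : int, lam r - lam s != k%:~R.

Let h := \prod_(r < n) \prod_(j < (nr r).+1) ('X - (lam r - j%:R)%:P) ^+ (m r j).
(** Pairs (r, j) label the exponents [e0]; adding k < m_{r,j} gives [T], which labels both the roots
    of [h] with multiplicity and the functions x^k e^{(lambda_r - j)x}. *)
Let T0 : finType := {r : 'I_n & 'I_(nr r).+1}.
Let e0 (t : T0) : C := lam (tag t) - (nat_of_ord (tagged t))%:R.
Let T : finType := {t : T0 & 'I_(m (tag t) (tagged t))}.

Definition monomials : seq K :=
  [seq X F ^+ (tagged t) * Ex F (e0 (tag t)) | t : T <- enum T].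

Lemma e0_inj : injective e0.
Proof.
move=> [r j] [s i]; rewrite /e0 /= => e.
have rs : r = s.
  apply/eqP/negP => /negP /lamZ /(_ (j%:Z - i%:Z)) /negP; apply; apply/eqP.
  have -> : lam r = lam s - i%:R + j%:R by rewrite -e subrK.
  by rewrite rmorphB /= -!pmulrn; ring.
subst s; congr existT; apply/val_inj/(natK_inj (F := F) char0) => /=.
by congr (cst F _); apply: oppr_inj; apply: addrI e.
Qed.

Lemma monomials_indep : lin_indep F monomials.
Proof.
apply: lin_indep_family => c; pose p (t : T0) : {poly C} :=
  \sum_(k < m (tag t) (tagged t)) c (existT _ t k) *: 'X^k.
have -> : \sum_(t : T) cst F (c t) * (X F ^+ (tagged t) * Ex F (e0 (tag t))) =
    \sum_(t : T0) (cop (p t)).[X F] * Ex F (e0 t).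
  transitivity (\sum_(t : T0) \sum_(k < m (tag t) (tagged t))
      cst F (c (existT _ t k)) * (X F ^+ k * Ex F (e0 t))).
    by rewrite sig_big_dep /=; apply: eq_bigr => -[t k] _.
  apply: eq_bigr => t _; rewrite rmorph_sum /= horner_sum mulr_suml.
  by apply: eq_bigr => k _; rewrite map_polyZ /= map_polyXn hornerZ hornerXn mulrA.
move/(expoly_indep char0 e0_inj) => p0 [t k].
have := congr1 (fun q : {poly C} => q`_k) (p0 t); rewrite /p coef_sum coef0.
rewrite (bigD1 k) //= coefZ coefXn eqxx mulr1 big1 ?addr0 // => i ik.
by rewrite coefZ coefXn eq_sym val_eqE (negPf ik) mulr0.
Qed.

Lemma hE : h = \prod_(t : T) ('X - (e0 (tag t))%:P).
Proof.
transitivity (\prod_(t : T0) \prod_(k < m (tag t) (tagged t)) ('X - (e0 t)%:P)).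
  rewrite /h sig_big_dep /=; apply: eq_bigr => -[r j] _ /=.
  by rewrite prodr_const card_ord.
by rewrite sig_big_dep /=; apply: eq_bigr => -[t k] _.
Qed.

Lemma size_monomials : (size monomials).+1 = size h.
Proof. by rewrite hE size_prod_XsubC size_map enumT. Qed.

Lemma monomials_ker u : u \in monomials -> applyop F (cop h) u = 0.
Proof.
case/mapP=> -[[r j] k] _ -> /=; apply: applyop_cop_monomial.
rewrite /h (bigD1 r) //= (bigD1 j) //= -mulrA dvdp_mulr //.
exact: dvdp_exp2l.
Qed.

(** A solution outside the span would give one independent solution more than the order of h(d). *)
Lemma ker_monomials a : applyop F (cop h) a = 0 -> in_span F monomials a.
Proof.
move=> ha; apply: NNPP => na.
have iS : lin_indep F (a :: monomials).
  by apply/lin_indep_cons; split=> //; apply: monomials_indep.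
have h0 : cop h != 0.
  rewrite map_poly_eq0 -size_poly_gt0 -size_monomials //.
have := lin_indep_ker_size char0 h0 iS; rewrite size_map_poly -size_monomials ltnn.
move=> H; suff: false by []; apply: H => u; rewrite inE => /orP[/eqP -> //|].
exact: monomials_ker.
Qed.

End Kernel.
End Factor.

(** * From chains to rational coefficients *)

Section Rational.
Variables (C : closedFieldType) (K : fieldType) (F : exp_diff_field C K).
Hypothesis char0 : [pchar C] =i pred0.

Notation expx := (expx F).
Notation ev := (expoly F).
Notation rat := (rat_in_ex F).

(** * The field C(e^x) and its derivation *)

Lemma rat_expx p : rat (expx p).
Proof. by exists p, 1; rewrite -!expxE rmorph1 divr1 oner_neq0. Qed.

Lemma rat_div p q : expx q != 0 -> rat (expx p / expx q).
Proof. by exists p, q. Qed.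

Lemma rat0 : rat 0. Proof. by rewrite -(rmorph0 expx); apply: rat_expx. Qed.
Lemma rat1 : rat 1. Proof. by rewrite -(rmorph1 expx); apply: rat_expx. Qed.

Lemma ratD a b : rat a -> rat b -> rat (a + b).
Proof.
move=> [p [q [q0 ->]]] [p' [q' [q'0 ->]]]; rewrite -!expxE in q0 q'0 *.
rewrite (addf_div _ _ q0 q'0) -!rmorphM -rmorphD; apply: rat_div.
by rewrite rmorphM mulf_neq0.
Qed.

Lemma ratM a b : rat a -> rat b -> rat (a * b).
Proof.
move=> [p [q [q0 ->]]] [p' [q' [q'0 ->]]]; rewrite -!expxE in q0 q'0 *.
by rewrite mulf_div -!rmorphM; apply: rat_div; rewrite rmorphM mulf_neq0.
Qed.

Lemma ratN a : rat a -> rat (- a).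
Proof. by move=> ra; rewrite -mulN1r -(rmorphN1 expx); apply: ratM => //;
  apply: rat_expx. Qed.

Lemma rat_sum (I : Type) (r : seq I) (p : pred I) (a : I -> K) :
  (forall i, p i -> rat (a i)) -> rat (\sum_(i <- r | p i) a i).
Proof.
move=> h; elim/big_rec: _ => [|i x pi hx]; first exact: rat0.
by apply: ratD => //; apply: h.
Qed.

Lemma ratDer a : rat a -> rat (D F a).
Proof.
move=> [p [q [q0 ->]]]; rewrite -!expxE in q0 *; set x := expx p / expx q.
have : D F (expx p) = D F x * expx q + x * D F (expx q) by rewrite -D_mul divfK.
rewrite !D_expx => e.
have -> : D F x = expx (theta p * q - p * theta q) / expx (q * q).
  have -> : expx (theta p * q - p * theta q) = expx (theta p) * expx q - expx p *
    expx (theta q).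
    by rewrite rmorphB !rmorphM.
  by rewrite [expx (q * q)]rmorphM e /x /=; field.
by apply: rat_div; rewrite rmorphM mulf_neq0.
Qed.

Lemma rat_iter_opD (P : {poly K}) : (forall i, rat P`_i) ->
  forall k i, rat (iter k (opD F) P)`_i.
Proof.
move=> h k; elim: k => //= k IH i; rewrite coef_opD; apply: ratD.
  exact/ratDer/IH.
by case: i => [|i]; [exact: rat0 | exact: IH].
Qed.

(** Descending recursion: the coefficient of d^(ord P + k) in QP is Q_k plus contributions of the
    Q_i d^i P, which vanish for i < k and are rational for i > k. *)
Lemma rat_left_factor (P Q : {poly K}) (h : {poly C}) : P \is monic ->
  opcomp F Q P = map_poly (cst F) h -> (forall i, rat P`_i) -> forall i, rat Q`_i.
Proof.
move=> mP QPh rP.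
(* Induction on j, which bounds the distance from k to the size of Q. *)
suff step j k : (size Q <= j + k)%N -> rat Q`_k by move=> k;
  apply: (step (size Q)); apply: leq_addr.
elim: j k => [|j IH] k le; first by rewrite nth_default //; apply: rat0.
have [le'|lt] := leqP (size Q) k; first by rewrite nth_default //; apply: rat0.
have IH' i : (k < i)%N -> rat Q`_i.
  by move=> ki; apply: IH; rewrite (leq_trans le) // addSnnS leq_add2l.
have := congr1 (fun A : {poly K} => A`_((size P).-1 + k)) QPh.
rewrite coef_map /opcomp coef_sum (bigD1 (Ordinal lt)) //= coefZ lead_iter_opD (eqP
  mP) mulr1.
move/(canRL (addrK _)) => ->; apply: ratD; first by rewrite -expxC; apply: rat_expx.
apply/ratN/rat_sum => i; rewrite -val_eqE /= => ik; rewrite coefZ.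
have [ki|ik'] := ltnP k i; first by apply: ratM; [exact: IH' | exact: rat_iter_opD].
rewrite [X in _ * X]nth_default ?mulr0; first exact: rat0.
apply: leq_trans (size_iter_opD _ _ _) _.
have {}ik' : (i < k)%N by rewrite ltn_neqAle ik.
have P0 : (0 < size P)%N by rewrite size_poly_gt0 monic_neq0.
by rewrite -(prednK P0) /= addSn -addnS leq_add2l.
Qed.

(** Cramer's rule on d independent columns of [G]; determinant and adjugate are formed over C[s] and
    then evaluated at e^x. *)
Lemma rat_solution d N (G : 'M[{poly C}]_(d, N)) (g : 'rV[{poly C}]_N) (p : 'rV[K]_d) :
  p *m map_mx expx G = map_mx expx g -> row_free (map_mx expx G) ->
  forall i, rat (p 0 i).
Proof.
move=> pG free i.
have full : row_full (map_mx expx G)^T by rewrite /row_full mxrank_tr; exact: free.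
set f := fullrankfun full; set H := rowsub f G^T.
have HK : map_mx expx H = rowsub f (map_mx expx G)^T.
  by apply/matrixP=> a b; rewrite !mxE.
have uH : map_mx expx H \in unitmx by rewrite HK fullrowsub_unit.
have e : map_mx expx H *m p^T = map_mx expx (rowsub f g^T).
  rewrite HK mul_rowsub_mx -trmx_mul pG.
  by apply/matrixP=> a b; rewrite !mxE.
have det0 : expx (\det H) != 0 by rewrite -det_map_mx -unitfE -unitmxE.
have -> : p 0 i = expx ((\adj H *m rowsub f g^T) i 0) / expx (\det H).
  apply: (canRL (mulfK det0)); have /matrixP/(_ i 0) :=
    congr1 (mulmx (map_mx expx (\adj H))) e.
  rewrite mulmxA -!map_mxM mul_adj_mx map_scalar_mx mul_scalar_mx !mxE mulrC => ->.
  by rewrite !rmorph_sum.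
exact: rat_div.
Qed.

Lemma derivn_scale_map (a : K) (w : {poly {poly C}}) l :
  (a *: map_poly expx w)^`(l) = a *: map_poly expx w^`(l).
Proof. by rewrite derivnZ derivn_map. Qed.

Lemma applyop_expoly_wide N (P : {poly K}) mu v : (size P <= N)%N ->
  applyop F P (ev mu v) =
  Ex F mu * (\sum_(i < N) P`_i *: map_poly expx (iter i (delta mu) v)).[X F].
Proof.
move=> le; rewrite (applyop_wide _ _ le) horner_sum mulr_sumr; apply: eq_bigr => i _.
by rewrite iterD_expoly hornerZ /expoly mulrCA.
Qed.

(** As d/dy commutes with [delta mu], P sends the l-th element to e^{mu x} R^(l)(x), where R is the
    sum of the P_i delta^i v, a polynomial in y. By Taylor expansion at y = x all these vanish
    exactly when R = 0. *)
Lemma applyop_chain_eq0 N (P : {poly K}) mu v : (size P <= N)%N ->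
  (forall l, applyop F P (ev mu v^`(l)) = 0) <->
  (forall k, \sum_(i < N) P`_i * expx (iter i (delta mu) v)`_k = 0).
Proof.
move=> le; set R := \sum_(i < N) P`_i *: map_poly expx (iter i (delta mu) v).
have RE k : \sum_(i < N) P`_i * expx (iter i (delta mu) v)`_k = R`_k.
  by rewrite coef_sum; apply: eq_bigr => i _; rewrite coefZ coef_map.
have PE l : applyop F P (ev mu v^`(l)) = Ex F mu * R^`(l).[X F].
  rewrite (applyop_expoly_wide _ _ le) raddf_sum; congr (_ * _.[_]).
  by apply: eq_bigr => i _; rewrite -iter_delta_derivn /= derivn_scale_map.
split=> [h k|h l].
  rewrite RE (poly_eq0_derivn F char0 (x := X F) (R := R)) ?coef0 // => l.
  by apply: (mulfI (Ex_neq0 F mu)); rewrite mulr0 -PE.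
rewrite PE (_ : R = 0); first by rewrite raddf0 horner0 mulr0.
by apply/polyP=> k; rewrite -RE h coef0.
Qed.

(* The equations [P u = 0] on a chain amount to a linear system with
   coefficients in [C[e^x]] for the coefficients of [P]; it determines a monic
   [P] of minimal order, so Cramer's rule applies. *)
Lemma rat_of_chains (P : {poly K}) (I : finType) (mu : I -> C) (v : I ->
  {poly {poly C}}) :
  P \is monic ->
  (forall i l, applyop F P (ev (mu i) (v i)^`(l)) = 0) ->
  (forall P' : {poly K}, (size P' <= (size P).-1)%N ->
     (forall i l, applyop F P' (ev (mu i) (v i)^`(l)) = 0) -> P' = 0) ->
  forall i, rat P`_i.
Proof.
move=> mP kP uniqP; set d := (size P).-1.
have sP : size P = d.+1 by rewrite prednK // size_poly_gt0 monic_neq0.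
pose T : finType := {i : I & 'I_(size (v i))}.
pose W j (t : T) : {poly C} := (iter j (delta (mu (tag t))) (v (tag t)))`_(tagged t).
(* Rows belong to the unknown coefficients of P below the top one, columns to the equations; the
   monic top term gives the right-hand side [g]. *)
pose G : 'M[{poly C}]_(d, #|T|) := \matrix_(j, t) W j (enum_val t).
pose g : 'rV[{poly C}]_#|T| := \row_t - W d (enum_val t).
have hP : (\row_(i < d) P`_i) *m map_mx expx G = map_mx expx g.
  apply/rowP=> t; rewrite !mxE.
  have := (applyop_chain_eq0 (mu (tag (enum_val t))) (v (tag (enum_val t))) (_ :
    size P <= d.+1)%N).1.
  rewrite sP => /(_ (leqnn _) (kP _) (tagged (enum_val t))).
  rewrite big_ord_recr /= -[P`_d]lead_coefE (eqP mP) mul1r => /eqP.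
  rewrite addr_eq0 raddfN => /eqP <-; apply: eq_bigr => i _.
  by rewrite !mxE.
have free : row_free (map_mx expx G).
  apply: inj_row_free => p pG.
  (* A row vector killed by [G] is an operator of order below that of P which kills every chain. *)
  pose P' := \poly_(i < d) (if insub i is Some j then p 0 j else 0).
  have P'E (i : 'I_d) : P'`_i = p 0 i by rewrite coef_poly ltn_ord valK.
  have /uniqP P'0 : (size P' <= d)%N by apply: size_poly.
  apply/rowP=> i; rewrite -P'E P'0 ?coef0 ?mxE // => {}i.
  apply/(applyop_chain_eq0 _ _ (size_poly _ _)) => k.
  have [lt|le] := ltnP k (size (v i)).
    pose t : T := existT _ i (Ordinal lt).
    have /rowP/(_ (enum_rank t)) := pG; rewrite !mxE; apply: etrans;
      apply: eq_bigr => j _.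
    by rewrite P'E !mxE enum_rankK.
  (* Beyond the size of v i the equations are trivial, since [delta] does not raise the degree in
     y. *)
  by rewrite big1 // => j _;
    rewrite [X in expx X]nth_default ?rmorph0 ?mulr0 // (leq_trans (size_iter_delta
    _ _ _)).
move=> i; have [lt|] := ltnP i d.
  by have := rat_solution hP free (Ordinal lt); rewrite mxE.
rewrite leq_eqVlt => /orP[/eqP <-|lt].
  by rewrite -[P`_d]lead_coefE (eqP mP); apply: rat1.
by rewrite nth_default ?sP //; apply: rat0.
Qed.

End Rational.

(** * Chains of a subspace stable under d/dy *)

Section Chains.
Variables (C : closedFieldType) (K : fieldType) (F : exp_diff_field C K).
Hypothesis char0 : [pchar C] =i pred0.

Notation expx := (expx F).
Notation ev := (expoly F).

Lemma expx_eq0 p : expx p = 0 -> p = 0.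
Proof.
move=> p0; have := @expoly_eq0 _ _ F char0 0 p%:P.
rewrite /expoly map_polyC hornerC /= p0 mulr0 => /(_ erefl) /eqP.
by rewrite polyC_eq0 => /eqP.
Qed.

Lemma expx_inj : injective expx.
Proof.
move=> p q e; apply/eqP; rewrite -subr_eq0; apply/eqP/expx_eq0.
by rewrite rmorphB /= e subrr.
Qed.

(** Leading coefficient in y, taken in [K] so that [lin_indep] and [in_span] apply; [expx] is
    injective, so nothing is lost. *)
Definition lead (v : {poly {poly C}}) : K := expx (lead_coef v).

(** The leading coefficients are combinations of 1, e^x, ..., e^{(d-1)x}, all killed by the
    constant-coefficient operator [A] of order d, so the kernel bound limits their number. *)
Lemma size_lead_indep d (g : seq {poly {poly C}}) :
  (forall x, x \in g -> size (lead_coef x) <= d)%N ->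
  lin_indep F [seq lead x | x <- g] -> (size g <= d)%N.
Proof.
move=> sd ig; pose A : {poly C} := \prod_(i < d) ('X - i%:R%:P).
have A0 : map_poly (cst F) A != 0.
  by rewrite map_poly_eq0 -size_poly_gt0 size_prod_XsubC.
have := lin_indep_ker_size char0 A0 ig.
rewrite size_map_poly size_prod_XsubC size_map -[index_enum _]enumT size_enum_ord ltnS.
apply=> _ /mapP[x /sd lex ->]; rewrite /lead expxE (horner_coef_wide _ (n := d));
  last first.
  by rewrite size_map_poly.
rewrite raddf_sum big1 // => i _; rewrite coef_map /= applyop_cstM -Ex_nat.
have := applyop_cop_monomial F (h := A) (a := i%:R) (k := 0).
rewrite !expr0 mul1r expr1 => ->; first by rewrite mulr0.
by rewrite /A (bigD1 i) //= dvdp_mulr.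
Qed.

Section Invariant.
(** A C-subspace of C[s][y] with sizes bounded by [M] in y and by [d] in s; it will be the part of
    ker P that lies in one W_r. *)
Variables (U : {poly {poly C}} -> Prop) (M d : nat).
Hypothesis U0 : U 0.
Hypothesis UP : forall c u v, U u -> U v -> U (c%:P *: u + v).
Hypothesis Uderiv : forall v, U v -> U v^`().
Hypothesis U_size : forall v, U v ->
  (size v <= M)%N /\ forall k, (size (v`_k)%R <= d)%N.

Lemma chain_nderivn v l : U v -> U v^`N(l).
Proof.
move=> Uv; have Ul : U v^`(l) by elim: l => [|l IH]; rewrite ?derivn0 // derivnS;
  apply: Uderiv.
have l0 : (l`!)%:R != 0 :> C by rewrite ((pcharf0P C).1 char0) -lt0n fact_gt0.
have -> : v^`N(l) = ((l`!)%:R^-1)%:P *: v^`(l) + 0.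
  rewrite addr0 nderivn_def -scaler_nat scalerA -polyC_natr -polyCM mulVf // scale1r //.
exact: UP.
Qed.

(** Sizes in y are treated from [M] down; at each size, elements are added while some leading
    coefficient is outside the span. Larger elements may serve for v because their y-derivatives
    stay in [U] with proportional leading coefficients. *)
Lemma greedy : exists g : seq {poly {poly C}},
  [/\ lin_indep F [seq lead x | x <- g], (forall x, x \in g -> U x) &
   forall v, U v ->
     in_span F [seq lead x | x : {poly {poly C}} <- g & (size v <= size x)%N] (lead v)].
Proof.
have step k : forall j, (k + j)%N = M.+1 -> exists g : seq {poly {poly C}},
  [/\ lin_indep F [seq lead x | x <- g], (forall x, x \in g -> U x /\ (k <= size x)%N) &
   forall v, U v -> (k <= size v)%N ->
     in_span F [seq lead x | x : {poly {poly C}} <- g & (size v <= size x)%N] (lead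
       v)]; last first.
  have [g [ig gU gspan]] := step 0%N M.+1 (add0n _).
  by exists g; split=> // [x /gU[]//|v Uv]; apply: gspan.
move=> j; elim: j k => [|j IH] k.
  rewrite addn0 => ->; exists [::]; split=> // v /U_size [le _].
  by rewrite ltnNge le.
rewrite addnS -addSn => /IH [g [ig gU gspan]].
(* The fuel p suffices: there are never more than d independent leading coefficients. *)
have ext p g' : (d < size g' + p)%N -> (forall x, x \in g' -> U x /\ size x = k) ->
    lin_indep F [seq lead x | x <- g' ++ g] ->
    exists g'', [/\ (forall x, x \in g'' -> U x /\ size x = k),
      lin_indep F [seq lead x | x <- g'' ++ g] &
      forall v, U v -> size v = k -> in_span F [seq lead x | x <- g'' ++ g] (lead v)].
  elim: p g' => [|p IHp] g' lt g'U ig'.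
    have : (size (g' ++ g) <= d)%N.
      apply: size_lead_indep ig' => x;
        rewrite mem_cat => /orP[/g'U[]|/gU[]] /U_size [_ h] _;
      by rewrite lead_coefE.
    by rewrite size_cat; move: lt; lia.
  case: (classic (exists v, [/\ U v, size v = k &
      ~ in_span F [seq lead x | x <- g' ++ g] (lead v)])) => [[v [Uv sv nv]]|nex].
    apply: (IHp (v :: g')); first by rewrite addSnnS.
      by move=> x; rewrite inE => /orP[/eqP->//|/g'U].
    exact/lin_indep_cons.
  exists g'; split=> // v Uv sv; apply: NNPP => nv; apply: nex.
  by exists v.
have [|//|//|g' [g'U ig' g'span]] := ext d.+1 [::]; first by rewrite add0n.
exists (g' ++ g); split=> // [x|v Uv].
  by rewrite mem_cat => /orP[/g'U[? ->]|/gU[? /ltnW]].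
rewrite leq_eqVlt => /orP[/eqP sv|lt]; rewrite filter_cat.
  rewrite !(all_filterP _); first by apply: g'span.
    by apply/allP=> x /gU[_ /ltnW]; rewrite sv.
  by apply/allP=> x /g'U[_ ->]; rewrite sv.
rewrite (_ : [seq x <- g' | _] = [::]); first exact: gspan.
rewrite -(filter_pred0 g'); apply: eq_in_filter => x /g'U[_ ->].
by apply/negbTE; rewrite -ltnNge.
Qed.

(** * Independence and spanning of the chains *)

Section Basis.
Variables (g : seq {poly {poly C}}) (mu : C).
Hypothesis g_indep : lin_indep F [seq lead x | x <- g].
Hypothesis gU : forall x, x \in g -> U x.

Lemma lead_ord_indep (b : 'I_(size g) -> C) :
  \sum_i (b i)%:P * lead_coef g`_i = 0 -> forall i, b i = 0.
Proof.
move=> b0; pose c k := if insub k is Some i then b i else 0.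
have cE (i : 'I_(size g)) : c i = b i by rewrite /c valK.
move=> i; rewrite -cE; apply: g_indep; last by rewrite size_map.
rewrite /lincomb size_map -[RHS](rmorph0 expx) -b0 rmorph_sum; apply: eq_bigr => k _.
by rewrite (nth_map 0) // cE rmorphM /= expxC.
Qed.

Let T : finType := {i : 'I_(size g) & 'I_(size (g`_i)%R)}.

(** Descending induction on the y-degree e: once the coefficients c of all elements of higher degree
    vanish, the coefficient of y^e is a combination of the leading coefficients of [g], scaled by
    binomials that are nonzero in characteristic 0. *)
Lemma chains_indep :
  lin_indep F [seq ev mu (g`_(tag t))^`N(tagged t) | t : T <- enum T].
Proof.
apply: lin_indep_family => c.
have -> : \sum_(t : T) cst F (c t) * ev mu (g`_(tag t))^`N(tagged t) =
    ev mu (\sum_(i < size g) \sum_(l < size (g`_i)%R) (c (existT _ i l))%:P *: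
      (g`_i)^`N(l)).
  rewrite sig_big_dep raddf_sum /=; apply: eq_bigr => -[i l] _ /=.
  by rewrite expolyZ expxC.
move/(expoly_eq0 char0) => Z0.
(* The y-degree of the l-th divided derivative is the size minus l + 1; for j = 0 no degree reaches
   e. *)
have step e : forall j, (M <= e + j)%N ->
    forall t : T, (size (g`_(tag t))%R - (tagged t).+1 >= e)%N -> c t = 0; last first.
  by move=> t; apply: (step 0%N M).
move=> j; elim: j e => [|j IH] e le.
  move=> [i l] /=; have [+ _] := U_size (gU (mem_nth 0 (ltn_ord i))).
  rewrite addn0 in le => sM le'; have := leq_trans (leq_trans sM le) le'.
  by rewrite leqNgt ltn_subrL /= (leq_ltn_trans (leq0n l) (ltn_ord l)).
have {}IH (t : T) : (e < size (g`_(tag t))%R - (tagged t).+1)%N -> c t = 0.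
  by apply: IH; rewrite addSnnS.
pose b (i : 'I_(size g)) := \sum_(l < size g`_i | (l + e)%N == (size (g`_i)%R).-1)
   c (existT _ i l) *+ 'C(l + e, l).
have b0 : forall i, b i = 0.
  apply: lead_ord_indep; have := congr1 (fun w : {poly {poly C}} => w`_e) Z0.
  rewrite coef0 coef_sum; apply: etrans; apply: eq_bigr => i _.
  rewrite coef_sum /b raddf_sum mulr_suml big_mkcond; apply: eq_bigr => l _ /=.
  rewrite coefZ coef_nderivn; case: eqP => [->|/eqP ne].
    by rewrite -lead_coefE raddfMn /= mulrnAl mulrnAr.
  have [lt|] := ltnP (l + e)%N (size (g`_i)%R).
    rewrite IH ?polyC0 ?mul0r //= ltn_subRL addSn ltn_neqAle lt andbT.
    by apply: contra ne => /eqP e'; rewrite -(congr1 predn e').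
  by move=> le'; rewrite nth_default // mul0rn mulr0.
move=> [i l] /=; rewrite leq_eqVlt => /orP[/eqP ee|]; last exact: (IH (existT _ i l)).
(* In the chain of a given g_i only one l yields degree e. *)
have := b0 i; rewrite /b (big_pred1 l) => [|k]; last first.
  have ar (s p q : nat) : (p < s)%N -> (q < s)%N ->
    ((q + (s - p.+1))%N == s.-1) = (q == p) by lia.
  by rewrite ee ar.
rewrite -mulr_natr => /eqP; rewrite mulf_eq0 ((pcharf0P C).1 char0) orbC.
by rewrite -leqn0 leqNgt bin_gt0 leq_addr => /eqP.
Qed.

Hypothesis g_span : forall v, U v ->
  in_span F [seq lead x | x : {poly {poly C}} <- g & (size v <= size x)%N] (lead v).

Lemma chains_span v (S : seq K) :
  (forall x l, x \in g -> (l < size x)%N -> in_span F S (ev mu x^`N(l))) ->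
  U v -> in_span F S (ev mu v).
Proof.
move=> gS; have [k] := ubnP (size v); elim: k v => // k IH v lt Uv.
have [->|v0] := eqVneq v 0; first by rewrite raddf0; apply: in_span0.
have sv : (0 < size v)%N by rewrite size_poly_gt0.
pose V y := exists z, [/\ U z, (size z <= size v)%N, y = expx z`_(size v).-1 &
  in_span F S (ev mu z)].
have [z [Uz sz /expx_inj ez zS]] : V (lead v).
  apply: (in_span_closed (V := V)) (g_span Uv).
  - by exists 0; rewrite size_poly0 coef0 !raddf0; split=> //; apply: in_span0.
  - move=> c y1 y2 [x [Ux sx -> xS]] [y [Uy sy -> yS]]; exists (c%:P *: x + y); split.
    + exact: UP.
    + by rewrite (leq_trans (size_polyD _ _)) // geq_max sy (leq_trans
      (size_scale_leq _ _)).
    + by rewrite coefD coefZ rmorphD rmorphM /= expxC.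
    + by rewrite raddfD /= expolyZ expxC; apply: in_spanP.
  move=> u /mapP[x]; rewrite mem_filter => /andP[svx xg] ->.
  (* Differentiating l times brings x down to the size of v; its leading coefficient gets multiplied
     by the binomial b. *)
  set l := (size x - size v)%N; set b := 'C((size x).-1, l).
  have b0 : b%:R != 0 :> C.
    by rewrite ((pcharf0P C).1 char0) -lt0n bin_gt0 /l; move: sv svx; lia.
  have lx : (l + (size v).-1 = (size x).-1)%N by rewrite /l; move: sv svx; lia.
  exists ((b%:R^-1)%:P *: x^`N(l)); split.
  - by rewrite -[_ *: _]addr0; apply: UP => //; apply/chain_nderivn/gU.
  - rewrite (leq_trans (size_scale_leq _ _)) //; apply/leq_sizeP => i le.
    by rewrite coef_nderivn nth_default ?mul0rn // -leq_subLR subKn.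
  - rewrite coefZ coef_nderivn lx -/b -lead_coefE -[lead_coef x *+ b]mulr_natr
    -polyC_natr mulrCA -polyCM.
    by rewrite mulVf // mulr1.
  - by rewrite expolyZ expxC; apply/in_spanZ/gS => //; rewrite /l; move: sv svx; lia.
rewrite -(subrK z v) raddfD; apply: in_spanD => //; apply: IH; last first.
  by rewrite addrC -scaleN1r -(polyCN 1); apply: UP.
have : (size (v - z)%R <= (size v).-1)%N.
  apply/leq_sizeP => i; rewrite leq_eqVlt coefB => /orP[/eqP <-|lt'].
    by rewrite -ez lead_coefE subrr.
  have le'' : (size v <= i)%N by rewrite -(prednK sv).
  by rewrite !nth_default ?subrr // (leq_trans sz).
by move/leq_ltn_trans; apply; rewrite -ltnS prednK.
Qed.

End Basis.
End Invariant.
End Chains.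

(** * The spaces W_r *)

Section Encoding.
Variables (C : closedFieldType) (K : fieldType) (F : exp_diff_field C K).
Hypothesis char0 : [pchar C] =i pred0.
Variables (n : nat) (lam : 'I_n -> C) (nr : 'I_n -> nat) (m : 'I_n -> nat -> nat).

Notation expx := (expx F).
Notation ev := (expoly F).

Definition max_mult r := (\max_(j < (nr r).+1) m r j)%N.

(** With s = e^x, e^{(lambda_r - j)x} is e^{(lambda_r - n_r)x} s^(n_r - j): the reversed index keeps
    the powers of s nonnegative. Values of c outside the range k < m_{r,j} are discarded. *)
Definition encode r (c : nat -> nat -> C) : {poly {poly C}} :=
  \poly_(k < max_mult r) \poly_(i < (nr r).+1)
    (if (k < m r (nr r - i))%N then c k (nr r - i)%N else 0).

Definition base r : C := lam r - (nr r)%:R.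

Lemma coef_encode r c k i : (encode r c)`_k`_i =
  if (i <= nr r)%N && (k < m r (nr r - i))%N then c k (nr r - i)%N else 0.
Proof.
rewrite /encode coef_poly; case: ltnP => [_|le]; first by rewrite coef_poly ltnS;
  case: (i <= _)%N.
rewrite coef0; case: ifP => // /andP[ile]; rewrite ltnNge (leq_trans _ le) //.
have lt : (nr r - i < (nr r).+1)%N by rewrite ltnS leq_subr.
exact: (leq_bigmax (F := fun j : 'I_(nr r).+1 => m r j) (Ordinal lt)).
Qed.

Lemma Phi_encode r c : Phi F lam nr m r c = Ex F (base r) *: map_poly expx (encode r c).
Proof.
apply/polyP=> k; rewrite coefZ coef_map /= /Phi coef_sum expxE.
rewrite (horner_coef_wide _ (n := (nr r).+1)); last first.
  rewrite (leq_trans (size_poly _ _)) //; apply/leq_sizeP => i le.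
  by rewrite coef_encode leqNgt le.
rewrite (reindex_inj rev_ord_inj) mulr_sumr; apply: eq_bigr => j _ /=.
rewrite subSS -(poly_def _ (fun k' => cst F (c k' (nr r - j)%N) * Ex F (lam r - (nr
  r - j)%:R))).
have jle : (j <= nr r)%N by rewrite -ltnS.
rewrite coef_poly coef_map coef_encode /= jle /=.
case: ifP => _; last by rewrite rmorph0 mul0r mulr0.
have -> : lam r - (nr r - j)%:R = base r + j%:R.
  by rewrite /base natrB //; ring.
by rewrite ExD Ex_nat mulrCA.
Qed.

Lemma elem_encode r c l : elem F lam nr m r c l = ev (base r) (encode r c)^`N(l).
Proof. by rewrite /elem Phi_encode nderivnZ nderivn_map hornerZ. Qed.

(** [l0] is the y-degree of a nonzero encoding; for the zero encoding it is the empty maximum 0, one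
    more than the size allows. *)
Lemma size_encode r c : (size (encode r c) <= (l0 nr m r c).+1)%N.
Proof.
apply/leq_sizeP => k lt; apply/polyP=> i; rewrite coef_encode coef0.
case: ifP => // /andP[ile klt]; apply/eqP; apply: contraTT lt => ck;
  rewrite -ltnNge ltnS.
have jlt : (nr r - i < (nr r).+1)%N by rewrite ltnS leq_subr.
apply: (leq_trans (_ : k <= \max_(k' < m r (nr r - i) | c k' (nr r - i)%N != 0%R)
  k')%N).
  exact: (leq_bigmax_cond (Ordinal klt)).
exact: (leq_bigmax (F :=
  fun j : 'I_(nr r).+1 => (\max_(k' < m r j | c k' j != 0%R) k')%N) (Ordinal jlt)).
Qed.

Lemma l0_lt_size r c : encode r c != 0 -> (l0 nr m r c < size (encode r c))%N.
Proof.
move=> v0; rewrite -(prednK (_ : 0 < size (encode r c))%N) ?size_poly_gt0 // ltnS.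
apply/bigmax_leqP => j _; apply/bigmax_leqP => k ck.
rewrite -ltnS prednK ?size_poly_gt0 // ltnNge; apply: contra ck => le.
have := coef_encode r c k (nr r - j)%N; rewrite [(encode r c)`_k]nth_default // coef0.
have jle : (j <= nr r)%N by rewrite -ltnS.
by rewrite leq_subr subKn // ltn_ord /= => <-.
Qed.

(** W_r inside C[s][y], described by support: s^i y^k stands for x^k e^{(lambda_r - n_r + i)x}. *)
Definition in_W r (v : {poly {poly C}}) :=
  forall k i, v`_k`_i != 0 -> (i <= nr r)%N && (k < m r (nr r - i))%N.

Lemma in_W_encode r v : in_W r v -> encode r (fun k j => v`_k`_(nr r - j)) = v.
Proof.
move=> Wv; apply/polyP=> k; apply/polyP=> i; rewrite coef_encode.
case: ifP => [/andP[ile _]|h]; first by rewrite subKn.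
by apply/esym/eqP; apply: contraFT h => /Wv.
Qed.

Lemma in_W0 r : in_W r 0. Proof. by move=> k i; rewrite !coef0 eqxx. Qed.

Lemma in_WP r c u v : in_W r u -> in_W r v -> in_W r (c%:P *: u + v).
Proof.
move=> Wu Wv k i; rewrite coefD coefZ coefD coefCM => h.
have [u0|/Wu //] := eqVneq (u`_k`_i) 0.
by apply: Wv; rewrite u0 mulr0 add0r in h.
Qed.

Lemma in_W_deriv r v : in_W r v -> in_W r v^`().
Proof.
move=> Wv k i; rewrite coef_deriv coefMn => h.
have /Wv/andP[-> /ltnW //] : v`_k.+1`_i != 0.
by apply: contraNneq h => ->; rewrite mul0rn.
Qed.

Lemma size_in_W r v : in_W r v ->
  (size v <= max_mult r)%N /\ forall k, (size (v`_k)%R <= (nr r).+1)%N.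
Proof.
move=> Wv; rewrite -(in_W_encode Wv); split=> [|k]; first exact: size_poly.
by apply/leq_sizeP => i le; rewrite coef_encode leqNgt le.
Qed.

Lemma in_W_span r v : in_W r v -> in_span F (W_list F lam nr m r) (ev (base r) v).
Proof.
move=> Wv; have -> : ev (base r) v = (Phi F lam nr m r (fun k j => v`_k`_(nr r -
  j))).[X F].
  by rewrite Phi_encode hornerZ (in_W_encode Wv).
rewrite /Phi horner_sum; apply: in_span_sum => j _.
rewrite horner_sum; apply: in_span_sum => k _.
rewrite hornerZ hornerXn -mulrA [Ex F _ * _]mulrC; apply/in_spanZ/in_span_mem.
apply/flattenP; exists [seq X F ^+ k * Ex F (lam r - j%:R) | k <- iota 0 (m r j)].
  by apply: (map_f (fun j => [seq X F ^+ k * Ex F (lam r - j%:R) | k <- iota 0 (m r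
    j)])); rewrite mem_iota /= add0n.
by apply: (map_f (fun k => X F ^+ k * Ex F (lam r - j%:R))); rewrite mem_iota /= add0n.
Qed.

Lemma monomials_sum_in_W a : in_span F (monomials F lam nr m) a ->
  exists v, (forall r, in_W r (v r)) /\ a = \sum_r ev (base r) (v r).
Proof.
pose V a := exists v, (forall r, in_W r (v r)) /\ a = \sum_r ev (base r) (v r).
apply: (in_span_closed (V := V)).
- by exists (fun=> 0); split=> [r|]; [exact: in_W0 | rewrite big1 // => r _;
  rewrite raddf0].
- move=> c x y [u [Wu ->]] [v [Wv ->]]; exists (fun r => c%:P *: u r + v r).
  split=> [r|]; first exact: in_WP.
  rewrite mulr_sumr -big_split; apply: eq_bigr => r _.
  by rewrite raddfD /= expolyZ expxC.
move=> b /mapP[[[r j] k] _ -> /=]; rewrite /= in k *.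
(* The monomial x^k e^{(lambda_r - j)x} is s^(n_r - j) y^k in component r. *)
exists (fun s => if s == r then 'X^(nr r - j) *: 'X^k else 0); split=> [s|].
  case: eqP => [->|_]; last exact: in_W0.
  have jle : (j <= nr r)%N by rewrite -ltnS.
  move=> k' i; rewrite coefZ coefXn; have [->|_] := eqVneq k' k; last
    by rewrite mulr0 coef0 eqxx.
  rewrite mulr1 coefXn; have [->|_] := eqVneq i (nr r - j)%N; last by rewrite eqxx.
  by rewrite leq_subr subKn // ltn_ord.
rewrite (bigD1 r) //= eqxx big1 => [|s /negPf ->]; last by rewrite raddf0.
have jle : (j <= nr r)%N by rewrite -ltnS.
have -> : lam r - j%:R = (nr r - j)%:R + base r.
  by rewrite [RHS]addrC /base (natrB _ jle) addrA subrK.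
by rewrite addr0 expolyZ expxXn /expoly map_polyXn hornerXn mulrA -ExD mulrC.
Qed.

Lemma base_subr : (forall r s : 'I_n, r != s ->
  forall k : int, lam r - lam s != k%:~R) ->
  forall r s, r != s -> forall k : int, base r - base s != k%:~R.
Proof.
move=> lamZ r s rs k; apply: contra (lamZ r s rs (k + (nr r)%:Z - (nr s)%:Z)) => /eqP e.
rewrite rmorphB rmorphD /= -e /base -!pmulrn; apply/eqP; ring.
Qed.

End Encoding.

(** * Operators with coefficients in C(e^x) *)

Section TrigKernel.
Variables (C : closedFieldType) (K : fieldType) (F : exp_diff_field C K).
Hypothesis char0 : [pchar C] =i pred0.

(* Clearing denominators turns a trigonometric operator into one acting on
   C[s][y], where it commutes with the nilpotent derivation d/dy. *)
Lemma trig_operator (P : {poly K}) : (forall i, rat_in_ex F P`_i) ->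
  exists (L : C -> {poly {poly C}} -> {poly {poly C}}),
    (exists2 q, q != 0 &
       forall mu v, q * applyop F P (expoly F mu v) = expoly F mu (L mu v)) /\
    forall mu v, (L mu v)^`() = L mu v^`().
Proof.
move=> rP; have /fin_all_exists [p hp] : forall i : 'I_(size P), exists p : {poly C},
    exists q, expx F q != 0 /\ P`_i = expx F p / expx F q by move=> i; apply: rP.
have /fin_all_exists [q hq] := hp.
(* Multiplying by the product of all denominators leaves each p i times the other denominators. *)
pose L mu v :=
  \sum_(i < size P) (p i * \prod_(j < size P | j != i) q j) *: iter i (delta mu) v.
exists L; split=> [|mu v].
  exists (expx F (\prod_(i < size P) q i)) => [|mu v].
    by rewrite rmorph_prod; apply/prodf_neq0 => i _; case: (hq i).
  rewrite /L raddf_sum mulr_sumr; apply: eq_bigr => i _ /=.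
  have [qi0 ->] := hq i; rewrite iterD_expoly expolyZ mulrA; congr (_ * _).
  by rewrite (bigD1 i) //= !rmorphM /=; field.
rewrite /L raddf_sum; apply: eq_bigr => i _ /=.
by rewrite derivZ -derivn1 iter_delta_derivn.
Qed.

End TrigKernel.

(** * The kernel of P *)

Section Main.
Variables (C : closedFieldType) (K : fieldType) (F : exp_diff_field C K).
Hypothesis char0 : [pchar C] =i pred0.
Variables (f g : {poly C}) (P Q : {poly K}).
Variables (n : nat) (lam : 'I_n -> C) (nr : 'I_n -> nat) (m : 'I_n -> nat -> nat).
Hypothesis dar : darboux F f g P Q.
Hypothesis fgE : f * g =
  \prod_(r < n) \prod_(j < (nr r).+1) ('X - (lam r - j%:R)%:P) ^+ (m r j).
Hypothesis lamZ : forall r s : 'I_n, r != s -> forall k : int, lam r - lam s != k%:~R.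

Notation ev := (expoly F).
Notation base := (base lam nr).
Notation encode := (encode nr m).

(** h(d) has as many independent solutions as its order, and its right factor P inherits this
    property. *)
Lemma darboux_full_kernel : exists S, [/\ lin_indep F S,
  (forall u, u \in S -> applyop F P u = 0) & ((size P).-1 <= size S)%N].
Proof.
have QP := opcomp_darboux char0 dar; have [[_ _ mP mQ] _] := dar.
have iS := monomials_indep (F := F) char0 (nr := nr) (m := m) lamZ.
have sS : (size (monomials F lam nr m)).+1 = size (opcomp F Q P).
  by rewrite QP size_map_poly fgE; apply: size_monomials.
have kS u : u \in monomials F lam nr m -> applyop F (opcomp F Q P) u = 0.
  by move=> uS; rewrite QP fgE; apply: monomials_ker uS.
have := full_kernel char0 mP (monic_neq0 mQ) iS sS kS.
by [].
Qed.

Lemma ker_decompose a : applyop F P a = 0 ->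
  exists v, (forall r, in_W nr m r (v r)) /\ a = \sum_r ev (base r) (v r).
Proof.
move=> Pa; apply: monomials_sum_in_W; apply: (ker_monomials char0 lamZ).
by rewrite -fgE -(opcomp_darboux char0 dar) applyop_comp Pa raddf0.
Qed.

(** * From a trigonometric operator to chains *)

Section Trigonometric.
Hypothesis ratP : forall i, rat_in_ex F P`_i.

Let U r v := in_W nr m r v /\ applyop F P (ev (base r) v) = 0.

(** P kills the image of v exactly when L v = 0. Stability follows because L commutes with d/dy, and
    the splitting because the exponents of distinct r differ by no integer. *)
Lemma ker_invariant : [/\ forall r v, U r v -> U r v^`() &
  forall v, \sum_r applyop F P (ev (base r) (v r)) = 0 ->
    forall r, applyop F P (ev (base r) (v r)) = 0].
Proof.
have [L [[q q0 LE] Lderiv]] := trig_operator ratP.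
have L0 mu v : applyop F P (ev mu v) = 0 <-> L mu v = 0.
  split=> [h|h]; first by apply: (@expoly_eq0 _ _ F char0 mu); rewrite -LE h mulr0.
  by apply: (mulfI q0); rewrite LE h raddf0 mulr0.
split=> [r v [Wv /L0 Lv]|v sum0 r].
  split; first exact: in_W_deriv.
  by apply/L0; rewrite -Lderiv Lv raddf0.
apply/L0; move: r; apply: (expoly_sum_eq0 (F := F) char0 (base_subr nr lamZ)).
by under eq_bigr do rewrite -LE; rewrite -mulr_sumr sum0 mulr0.
Qed.

Lemma ker_WP r c u v : U r u -> U r v -> U r (c%:P *: u + v).
Proof.
move=> [Wu Pu] [Wv Pv]; split; first exact: in_WP.
by rewrite raddfD /= expolyZ expxC raddfD /= applyop_cstM Pu Pv mulr0 addr0.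
Qed.

Lemma ker_W0 r : U r 0.
Proof. by split; [exact: in_W0 | rewrite !raddf0]. Qed.

Lemma ker_W_size r v : U r v ->
  (size v <= max_mult nr m r)%N /\ forall k, (size (v`_k)%R <= (nr r).+1)%N.
Proof. by case=> Wv _; apply: size_in_W. Qed.

(** Chains come from the greedy choice in each [U r]. They span ker P since the components of a
    solution are solutions, and the sum is direct by distinctness of the exponents modulo Z. *)
Lemma trig_chains :
  exists (B : 'I_n -> seq K) (N : 'I_n -> nat)
         (c : forall r : 'I_n, 'I_(N r) -> nat -> nat -> C),
    [/\ forall r, is_basis F (in_span F (B r)) (B r) /\
                  (forall b, b \in B r -> in_span F (W_list F lam nr m r) b),
        forall r b, b \in B r <->
          exists (i : 'I_(N r)) (l : nat),
            (l <= l0 nr m r (c r i))%N /\ b = elem F lam nr m r (c r i) l,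
        forall a : K, applyop F P a = 0 <->
          exists v : 'I_n -> K,
            (forall r, in_span F (B r) (v r)) /\ a = \sum_(r < n) v r &
        forall v : 'I_n -> K, (forall r, in_span F (B r) (v r)) ->
          \sum_(r < n) v r = 0 -> forall r, v r = 0].
Proof.
have [Uderiv Usum] := ker_invariant.
have /fin_all_exists [G hG] := fun r => greedy F char0 (@ker_W_size r).
pose T r : finType := {i : 'I_(size (G r)) & 'I_(size (G r)`_i)}.
pose B r := [seq ev (base r) ((G r)`_(tag t))^`N(tagged t) | t : T r <- enum (T r)].
(* Coefficients read back from [G r], inverting [encode]. *)
pose c r (i : 'I_(size (G r))) k j := (G r)`_i`_k`_(nr r - j).
have GU r i : (i < size (G r))%N -> U r (G r)`_i by have [_ h _] := hG r => /mem_nth/h.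
have cE r i : encode r (c r i) = (G r)`_i.
  by apply: in_W_encode; have [] := GU r i (ltn_ord i).
(* Independent leading coefficients are nonzero, so every member of [G r] is nonzero and its chain
   runs exactly over l <= [l0]. *)
have l0E r (i : 'I_(size (G r))) : (l0 nr m r (c r i)).+1 = size (G r)`_i.
  apply/eqP; rewrite eqn_leq -{2}(cE r i) size_encode andbT -(cE r i) l0_lt_size // cE.
  apply/eqP => G0; have [ind _ _] := hG r.
  have sum0 : \sum_(k < size (G r)) ((k == i)%:R : C)%:P * lead_coef (G r)`_k = 0.
    rewrite big1 // => k _; have [->|_] := eqVneq k i; last by rewrite mul0r.
    by rewrite G0 lead_coef0 mulr0.
  by have /eqP := lead_ord_indep ind sum0 i; rewrite eqxx oner_eq0.
have BE r b : b \in B r <-> exists (i : 'I_(size (G r))) l, (l <= l0 nr m r (c r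
  i))%N /\
    b = elem F lam nr m r (c r i) l.
  split=> [/mapP[[i l] _ ->]|[i [l [ll ->]]]].
    by exists i, l; rewrite elem_encode cE -ltnS l0E ltn_ord.
  rewrite -ltnS l0E in ll.
  by apply/mapP; exists (existT _ i (Ordinal ll) : T r);
    rewrite ?mem_enum // elem_encode cE.
have Bev r b : b \in B r -> exists v, U r v /\ b = ev (base r) v.
  move=> /mapP[[i l] _ -> /=]; exists ((G r)`_i)^`N(l); split=> //.
  by apply: (chain_nderivn char0 (@ker_W0 r) (@ker_WP r) (Uderiv r)); apply: GU.
have spanB r a : in_span F (B r) a -> exists v, U r v /\ a = ev (base r) v.
  apply: (in_span_closed (V := fun a => exists v, U r v /\ a = ev (base r) v)) (Bev r).
    by exists 0; split; [exact: ker_W0 | rewrite raddf0].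
  move=> d x y [u [Uu ->]] [v [Uv ->]]; exists (d%:P *: u + v); split;
    first exact: ker_WP.
  by rewrite raddfD /= expolyZ expxC.
have iB r : lin_indep F (B r).
  have [ind GUr _] := hG r.
  exact: (@chains_indep _ _ F char0 (U r) _ _ (@ker_W_size r) (G r) (base r) ind GUr).
exists B, (fun r => size (G r)), c; split=> [r|//|a|v Bv sum0].
- split; first by split=> //; apply: lin_indep_uniq (iB r).
  by move=> b /Bev [v [[Wv _] ->]]; apply: in_W_span.
- split=> [Pa|[v [Bv ->]]]; last first.
    rewrite raddf_sum big1 // => r _.
    by have [u [[_ Pu] ->]] := spanB r _ (Bv r).
  have [v [Wv aE]] := ker_decompose Pa.
  have Pv : forall r, applyop F P (ev (base r) (v r)) = 0.
    by apply: Usum; rewrite -[RHS]Pa aE raddf_sum.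
  exists (fun r => ev (base r) (v r)); split=> // r.
  have [ind GUr spanG] := hG r.
  apply: (chains_span char0 (@ker_W0 r) (@ker_WP r) (Uderiv r) GUr spanG) => [x l
    xG lx|//].
  apply/in_span_mem/BE.
  have ix : (index x (G r) < size (G r))%N by rewrite index_mem.
  exists (Ordinal ix), l; rewrite elem_encode cE -ltnS l0E /=.
  by rewrite nth_index.
have /fin_all_exists [w hw] := fun r => spanB r _ (Bv r).
move=> r; have [_ ->] := hw r; rewrite (expoly_sum_eq0 (F :=
  F) char0 (base_subr nr lamZ) (v := w)) ?raddf0 //.
by rewrite -[RHS]sum0; apply: eq_bigr => s _; have [_ ->] := hw s.
Qed.

End Trigonometric.

(** An operator of order below ord P that kills the chains kills all of ker P, whose dimension is at
    least ord P, hence is zero. This uniqueness makes P rational in e^x; Q follows from QP =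
    h(d). *)
Lemma chains_trig (B : 'I_n -> seq K) (N : 'I_n -> nat)
    (c : forall r : 'I_n, 'I_(N r) -> nat -> nat -> C) :
  (forall r b, b \in B r <->
     exists (i : 'I_(N r)) (l : nat),
       (l <= l0 nr m r (c r i))%N /\ b = elem F lam nr m r (c r i) l) ->
  (forall a : K, applyop F P a = 0 <->
     exists v : 'I_n -> K,
       (forall r, in_span F (B r) (v r)) /\ a = \sum_(r < n) v r) ->
  trigonometric F P Q.
Proof.
move=> BE kerE; have [[_ _ mP mQ] _] := dar.
pose I : finType := {r : 'I_n & 'I_(N r)}.
pose v (i : I) := encode (tag i) (c _ (tagged i)).
have derivnE (i : I) l : ev (base (tag i)) (v i)^`(l) =
    cst F (l`!)%:R * elem F lam nr m (tag i) (c _ (tagged i)) l.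
  by rewrite elem_encode nderivn_def raddfMn /= rmorph_nat mulr_natl.
have kerB r b : b \in B r -> applyop F P b = 0.
  move=> bB; apply/kerE; exists (fun s => if s == r then b else 0); split=> [s|].
    by case: eqP => [->|_]; [apply: in_span_mem | apply: in_span0].
  by rewrite (bigD1 r) //= eqxx big1 ?addr0 // => s /negPf ->.
have ratP : forall i, rat_in_ex F P`_i.
  apply: (rat_of_chains char0 (mu := fun i : I => base (tag i)) (v :=
    v) mP) => [[r i] l|P' sP' kP'].
    rewrite derivnE applyop_cstM /=; have [le|lt] := leqP l (l0 nr m r (c r i)).
      by rewrite (kerB r) ?mulr0 //; apply/BE; exists i, l.
    (* Beyond [l0], which bounds the y-degree, the derivatives are zero. *)
    rewrite elem_encode nderivn_poly0 ?raddf0 ?mulr0 ?raddf0 //.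
    exact: leq_trans (size_encode _ _ _ _) lt.
  have [S [iS kS leS]] := darboux_full_kernel.
  apply: (op_eq0_of_ker char0 iS (leq_trans sP' leS)) => u /kS /kerE [w [Bw ->]].
  rewrite raddf_sum big1 // => r _.
  apply: (in_span_closed (V := fun a => applyop F P' a = 0)) (Bw r).
  - by rewrite raddf0.
  - by move=> d x y hx hy; rewrite raddfD /= applyop_cstM hx hy mulr0 addr0.
  move=> b /BE [i [l [_ ->]]].
  have := kP' (existT _ r i) l; rewrite derivnE applyop_cstM /= => /eqP.
  rewrite mulf_eq0 fmorph_eq0 ((pcharf0P C).1 char0) -leqn0 leqNgt fact_gt0 /=.
  by move/eqP.
split=> //; exact: rat_left_factor mP (opcomp_darboux char0 dar) ratP.
Qed.

End Main.

Theorem theorem3p3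
  (C : closedFieldType) (K : fieldType) (F : exp_diff_field C K)
  (char0 : [pchar C] =i pred0)
  (f g : {poly C}) (P Q : {poly K})
  (n : nat) (lam : 'I_n -> C) (nr : 'I_n -> nat) (m : 'I_n -> nat -> nat) :
  darboux F f g P Q ->
  f * g = \prod_(r < n) \prod_(j < (nr r).+1)
            ('X - (lam r - j%:R)%:P) ^+ (m r j) ->
  (forall r s : 'I_n, r != s -> forall k : int, lam r - lam s != k%:~R) ->
  (forall r s : 'I_n, r != s -> lam r != lam s) ->
  (forall r : 'I_n, (0 < m r 0)%N) ->
  trigonometric F P Q <->
  exists (B : 'I_n -> seq K) (N : 'I_n -> nat)
         (c : forall r : 'I_n, 'I_(N r) -> nat -> nat -> C),
    [/\ (* K_r := span (B r) is a subspace of W_r with basis B r ... *)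
        forall r, is_basis F (in_span F (B r)) (B r) /\
                  (forall b, b \in B r -> in_span F (W_list F lam nr m r) b),
        (* ... and this basis is the union of the sets
           { (1/l!) d_y^l Phi_c(y)|_{y=x} : l = 0..l_0 } *)
        forall r b, b \in B r <->
          exists (i : 'I_(N r)) (l : nat),
            (l <= l0 nr m r (c r i))%N /\ b = elem F lam nr m r (c r i) l,
        (* ker P = K_1 + ... + K_n ... *)
        forall a : K, applyop F P a = 0 <->
          exists v : 'I_n -> K,
            (forall r, in_span F (B r) (v r)) /\ a = \sum_(r < n) v r &
        (* ... and the sum is direct *)
        forall v : 'I_n -> K, (forall r, in_span F (B r) (v r)) ->
          \sum_(r < n) v r = 0 -> forall r, v r = 0].
Proof.
move=> dar fgE lamZ _ _; split=> [[ratP _]|[B [N [c [_ BE kerE _]]]]].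
  exact: (trig_chains char0 dar fgE lamZ ratP).
exact: (chains_trig char0 dar fgE lamZ BE kerE).
Qed.
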